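(* Let $(\mathrm{Spec}(B),\underline f)$, $\underline f=(f_1,\dots,f_n)\in B^n$, be an $n$-dimensional affine Landau-Ginzburg model over $S=\mathrm{Spec}(A)$. Then every object of the dg category of relative singularities $\mathbf{Sing}(B,\underline f)$ is a retract of an object represented by a $K(B,\underline f)$-dg module concentrated in $n+1$ degrees.
   Context: $A$ is a noetherian regular local ring of finite Krull dimension, $S=\mathrm{Spec}(A)$, $n\ge 1$. An $n$-dimensional affine Landau-Ginzburg (LG) model over $S$ is a pair $(\mathrm{Spec}(B),\underline f)$ with $B$ a flat $A$-algebra of finite type and $\underline f:\mathrm{Spec}(B)\to\mathbb A^n_S$ an $S$-morphism, i.e. $\underline f=(f_1,\dots,f_n)\in B^n$. Dg categories are $A$-linear, considered in the $\infty$-category $\mathbf{dgCat}^{\mathrm{idm}}_S$ of small dg categories up to Morita equivalence (idempotent complete triangulated dg categories); quotients and fibers are taken there. For a derived scheme $Z$ of finite type over $S$ with cohomologically bounded structure sheaf, $\mathbf{Sing}(Z)=\mathbf{Coh}^b(Z)/\mathbf{Perf}(Z)$. Let $X=\mathrm{Spec}(B)$, let $X_0=X\times^h_{\mathbb A^n_S}S$ be the derived zero locus of $\underline f$, and $\mathfrak i:X_0\to X$. Then $\mathbf{Sing}(B,\underline f)=\mathbf{Sing}(X,\underline f)$ is the fiber of $\mathfrak i_*:\mathbf{Sing}(X_0)\to\mathbf{Sing}(X)$. Koszul algebra and strict model: $K(B,\underline f)=B[\varepsilon_1,\dots,\varepsilon_n]$ is the commutative dg algebra with $\varepsilon_i$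 in degree $-1$, $\varepsilon_i^2=0$, $\varepsilon_i\varepsilon_j=-\varepsilon_j\varepsilon_i$, $d\varepsilon_i=f_i$; it models $X_0$. A $K(B,\underline f)$-dg module is a cochain complex of $B$-modules $(E,d)$ with maps $h^1,\dots,h^n$ of degree $-1$ such that $(h^i)^2=0$, $[d,h^i]=f_i$, $[h^i,h^j]=0$ (graded commutators). $\mathrm{Coh}^s(B,\underline f)$ is the dg category of $K(B,\underline f)$-dg modules whose underlying complex of $B$-modules is strictly perfect (bounded, with finitely generated projective terms), and $\mathrm{Perf}^s(B,\underline f)$ is its full subcategory on the modules that are perfect over $K(B,\underline f)$. There is an equivalence $\mathrm{Coh}^s(B,\underline f)/\mathrm{Perf}^s(B,\underline f)\simeq\mathbf{Sing}(B,\underline f)$. An object of $\mathbf{Sing}(B,\underline f)$ is represented by a dg module $E\in\mathrm{Coh}^s(B,\underline f)$ if it is equivalent to the image of $E$; $E$ is concentrated in $n+1$ degrees if there is $m\in\mathbb Z$ with $E_i=0$ for $i\notin[m,m+n]$. *)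

(* Defs.v *)
From HB Require Import structures.
From mathcomp Require Import all_boot all_order all_algebra.

Set Implicit Arguments.
Unset Strict Implicit.
Unset Printing Implicit Defensive.

Import Order.TTheory GRing.Theory Num.Theory.
Local Open Scope ring_scope.

Definition is_unit (A : comPzRingType) (a : A) : Prop := exists b, b * a = 1.

Definition is_ideal (A : comPzRingType) (I : A -> Prop) : Prop :=
  [/\ I 0, forall a b, I a -> I b -> I (a + b) & forall a b, I b -> I (a * b)].

Definition generates (A : comPzRingType) (k : nat) (x : 'I_k -> A)
    (I : A -> Prop) : Prop :=
  forall a, I a <-> exists c : 'I_k -> A, a = \sum_(j < k) c j * x j.

Definition noetherian (A : comPzRingType) : Prop :=
  forall I : A -> Prop, is_ideal I -> exists k (x : 'I_k -> A), generates x I.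

Definition is_prime_ideal (A : comPzRingType) (P : A -> Prop) : Prop :=
  [/\ is_ideal P, ~ P 1 & forall a b, P (a * b) -> P a \/ P b].

Definition prime_chain (A : comPzRingType) (d : nat) (P : nat -> A -> Prop) :=
  (forall i, (i <= d)%N -> is_prime_ideal (P i)) /\
  (forall i, (i < d)%N ->
     (forall a, P i a -> P i.+1 a) /\ exists2 a, P i.+1 a & ~ P i a).

Definition krull_dim (A : comPzRingType) (d : nat) : Prop :=
  (exists P : nat -> A -> Prop, prime_chain d P) /\
  (forall e (P : nat -> A -> Prop), prime_chain e P -> (e <= d)%N).

Definition local_ring (A : comNzRingType) : Prop :=
  is_ideal (fun a : A => ~ is_unit a).

(* The non-units of a local ring form its maximal ideal; regularity asks that
   it be generated by as many elements as the Krull dimension. *)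
Definition regular_local_ring (A : comNzRingType) : Prop :=
  [/\ noetherian A, local_ring A &
      exists2 d, krull_dim A d &
        exists x : 'I_d -> A, generates x (fun a : A => ~ is_unit a)].

(* An A-algebra is given by its structure morphism phi : A -> B; the zero ring
   is allowed for B. *)
Definition finite_type (A B : comPzRingType) (phi : {rmorphism A -> B}) : Prop :=
  exists k (b : 'I_k -> B), forall P : B -> Prop,
    (forall a, P (phi a)) -> (forall j, P (b j)) ->
    (forall x y, P x -> P y -> P (x + y)) ->
    (forall x y, P x -> P y -> P (x * y)) -> forall y, P y.

(* [tensor_zero phi s] says that \sum_((m, b) <- s) m (x) b vanishes in
   M (x)_A B: by the universal property of the tensor product, this means that
   every A-bilinear map out of M x B kills it. *)
Definition bilinear_map (A B : comPzRingType) (phi : {rmorphism A -> B})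
    (M P : lmodType A) (t : M -> B -> P) : Prop :=
  [/\ forall m m' b, t (m + m') b = t m b + t m' b,
      forall m b b', t m (b + b') = t m b + t m b',
      forall a m b, t (a *: m) b = a *: t m b
    & forall a m b, t m (phi a * b) = a *: t m b].

Definition tensor_zero (A B : comPzRingType) (phi : {rmorphism A -> B})
    (M : lmodType A) (s : seq (M * B)) : Prop :=
  forall (P : lmodType A) (t : M -> B -> P),
    bilinear_map phi t -> \sum_(z <- s) t z.1 z.2 = 0.

(* - (x)_A B preserves injections. *)
Definition flat (A B : comPzRingType) (phi : {rmorphism A -> B}) : Prop :=
  forall (M N : lmodType A) (u : {linear M -> N}), injective u ->
  forall s : seq (M * B),
    tensor_zero phi [seq (u z.1, z.2) | z <- s] -> tensor_zero phi s.

(* K(B,f)-dg modules, with cohomological grading.  The graded B-module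
   (E_i)_(i : int) is presented internally, as the direct sum E of its
   components together with the projections dg_pr i : E -> E onto E_i; thus x
   lies in E_i iff dg_pr i x = x.  For n = 0 these are just the cochain
   complexes of B-modules. *)
Record dgmod (B : comPzRingType) (n : nat) (f : 'I_n -> B) := DgMod {
  dg_car :> lmodType B;
  dg_pr : int -> {linear dg_car -> dg_car};
  dg_d : {linear dg_car -> dg_car};
  dg_h : 'I_n -> {linear dg_car -> dg_car};
  dg_prK : forall i j x, dg_pr i (dg_pr j x) = if i == j then dg_pr j x else 0;
  dg_sum : forall x, exists2 s : seq int, uniq s & x = \sum_(i <- s) dg_pr i x;
  dg_d_pr : forall i x, dg_d (dg_pr i x) = dg_pr (i + 1) (dg_d x);
  dg_h_pr : forall a i x, dg_h a (dg_pr i x) = dg_pr (i - 1) (dg_h a x);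
  dg_dd : forall x, dg_d (dg_d x) = 0;
  dg_hh : forall a x, dg_h a (dg_h a x) = 0;
  dg_hC : forall a b x, dg_h a (dg_h b x) + dg_h b (dg_h a x) = 0;
  dg_dh : forall a x, dg_d (dg_h a x) + dg_h a (dg_d x) = f a *: x
}.

Section DgModules.

Variables (B : comPzRingType) (n : nat) (f : 'I_n -> B).
Implicit Types E F G : dgmod f.

Record dghom E F := DgHom {
  hom_fun :> {linear E -> F};
  hom_pr : forall i x, hom_fun (dg_pr E i x) = dg_pr F i (hom_fun x);
  hom_d : forall x, hom_fun (dg_d E x) = dg_d F (hom_fun x);
  hom_h : forall a x, hom_fun (dg_h E a x) = dg_h F a (hom_fun x)
}.

Definition hom_id E : dghom E E :=
  @DgHom E E idfun (fun _ _ => erefl) (fun _ => erefl) (fun _ _ => erefl).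

Program Definition hom_zero E F : dghom E F := @DgHom E F \0 _ _ _.
Next Obligation. by move=> E F i x /=; rewrite linear0. Qed.
Next Obligation. by move=> E F x /=; rewrite linear0. Qed.
Next Obligation. by move=> E F a x /=; rewrite linear0. Qed.

Program Definition hom_comp E F G (v : dghom F G) (u : dghom E F) : dghom E G :=
  @DgHom E G (v \o u) _ _ _.
Next Obligation. by move=> E F G v u i x /=; rewrite !hom_pr. Qed.
Next Obligation. by move=> E F G v u x /=; rewrite !hom_d. Qed.
Next Obligation. by move=> E F G v u a x /=; rewrite !hom_h. Qed.

(* A homotopy is a map of degree -1 that is K(B,f)-linear in the graded
   sense, i.e. it anticommutes with the h^a. *)
Definition homotopic E F (u v : dghom E F) : Prop :=
  exists s : {linear E -> F},
    [/\ forall i x, s (dg_pr E i x) = dg_pr F (i - 1) (s x),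
        forall a x, s (dg_h E a x) = - dg_h F a (s x)
      & forall x, u x - v x = dg_d F (s x) + s (dg_d E x)].

Definition quasi_iso E F (u : dghom E F) : Prop :=
  (forall x, dg_d E x = 0 -> (exists y, u x = dg_d F y) ->
     exists x', x = dg_d E x') /\
  (forall y, dg_d F y = 0 -> exists x y', dg_d E x = 0 /\ y = u x + dg_d F y').

Program Definition shift E : dgmod f :=
  @DgMod B n f E (fun i => dg_pr E (i + 1)) (\- dg_d E)
    (fun a => \- dg_h E a) _ _ _ _ _ _ _ _.
Next Obligation.
by move=> E i j x /=; rewrite dg_prK (inj_eq (addIr _)).
Qed.
Next Obligation.
move=> E x; have [s us {1}->] := dg_sum x.
exists [seq i - 1 | i <- s]; first by rewrite map_inj_uniq //; apply: addIr.
by rewrite big_map; apply: eq_bigr => i _ /=; rewrite subrK.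
Qed.
Next Obligation. by move=> E i x /=; rewrite dg_d_pr linearN. Qed.
Next Obligation.
by move=> E a i x /=; rewrite dg_h_pr linearN addrAC.
Qed.
Next Obligation. by move=> E x /=; rewrite linearN dg_dd !oppr0. Qed.
Next Obligation. by move=> E a x /=; rewrite linearN dg_hh !oppr0. Qed.
Next Obligation. by move=> E a b x /=; rewrite !linearN !opprK dg_hC. Qed.
Next Obligation. by move=> E a x /=; rewrite !linearN !opprK dg_dh. Qed.

Section Cone.

Variables (E F : dgmod f) (u : dghom E F).

Definition cone_pr (i : int) (z : E * F) : E * F :=
  (dg_pr E (i + 1) z.1, dg_pr F i z.2).
Definition cone_d (z : E * F) : E * F := (- dg_d E z.1, u z.1 + dg_d F z.2).
Definition cone_h (a : 'I_n) (z : E * F) : E * F :=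
  (- dg_h E a z.1, dg_h F a z.2).

Lemma cone_pr_linear i : linear (cone_pr i).
Proof. by move=> c [x y] [x' y']; congr pair => /=; rewrite linearP. Qed.

Lemma cone_d_linear : linear cone_d.
Proof.
move=> c [x y] [x' y']; congr pair => /=.
  by rewrite linearP opprD scalerN.
by rewrite !linearP scalerDr addrACA.
Qed.

Lemma cone_h_linear a : linear (cone_h a).
Proof.
move=> c [x y] [x' y']; congr pair => /=; rewrite linearP //.
by rewrite opprD scalerN.
Qed.

HB.instance Definition _ i :=
  GRing.isLinear.Build B (E * F)%type (E * F)%type *:%R (cone_pr i)
    (cone_pr_linear i).
HB.instance Definition _ :=
  GRing.isLinear.Build B (E * F)%type (E * F)%type *:%R cone_d cone_d_linear.
HB.instance Definition _ a :=
  GRing.isLinear.Build B (E * F)%type (E * F)%type *:%R (cone_h a)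
    (cone_h_linear a).

Lemma sum_pr_supp G (x : G) (s t : seq int) :
  uniq s -> x = \sum_(i <- s) dg_pr G i x -> uniq t -> {subset s <= t} ->
  x = \sum_(i <- t) dg_pr G i x.
Proof.
move=> us xE ut sub.
have P0 j : j \notin s -> dg_pr G j x = 0.
  move=> js; rewrite xE linear_sum big1_seq //= => i is_.
  by rewrite dg_prK; case: eqP js => // ->; rewrite is_.
rewrite (bigID (mem s)) /= [X in _ + X]big1 ?addr0; last by move=> j /P0.
rewrite -big_filter {1}xE; apply: perm_big.
apply: uniq_perm; rewrite ?filter_uniq // => i; rewrite mem_filter /=.
by case: (boolP (i \in s)) => //= /sub.
Qed.

Program Definition cone : dgmod f :=
  @DgMod B n f (E * F)%type cone_pr cone_d cone_h _ _ _ _ _ _ _ _.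
Next Obligation.
move=> i j [x y] /=; rewrite /cone_pr /= !dg_prK (inj_eq (addIr _)).
by case: eqP.
Qed.
Next Obligation.
move=> [x y]; have [s us xE] := dg_sum x; have [t ut yE] := dg_sum y.
pose r := undup ([seq i - 1 | i <- s] ++ t).
exists r; first exact: undup_uniq.
have ur : uniq [seq i + 1 | i <- r].
  by rewrite map_inj_uniq ?undup_uniq //; apply: addIr.
have {}xE : x = \sum_(i <- r) dg_pr E (i + 1) x.
  rewrite -(big_map (fun i => i + 1) predT (fun i => dg_pr E i x)).
  apply: sum_pr_supp us xE ur _ => i is_; apply/mapP; exists (i - 1).
    by rewrite mem_undup mem_cat (map_f (fun i => i - 1) is_).
  by rewrite subrK.
have {}yE : y = \sum_(i <- r) dg_pr F i y.
  apply: sum_pr_supp ut yE (undup_uniq _) _ => i it.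
  by rewrite mem_undup mem_cat it orbT.
rewrite {1}xE {1}yE /=.
by elim: r {ur xE yE} => [|i r IH]; rewrite ?big_nil // !big_cons -IH.
Qed.
Next Obligation.
move=> i [x y]; congr pair => /=; first by rewrite dg_d_pr linearN.
by rewrite linearD hom_pr dg_d_pr.
Qed.
Next Obligation.
move=> a i [x y]; congr pair => /=; rewrite dg_h_pr //.
by rewrite linearN addrAC.
Qed.
Next Obligation.
move=> [x y]; congr pair => /=; first by rewrite linearN dg_dd !oppr0.
by rewrite linearD linearN dg_dd addr0 hom_d addNr.
Qed.
Next Obligation.
move=> a [x y]; congr pair => /=; last exact: dg_hh.
by rewrite linearN dg_hh !oppr0.
Qed.
Next Obligation.
move=> a b [x y]; congr pair => /=; last exact: dg_hC.
by rewrite !linearN !opprK dg_hC.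
Qed.
Next Obligation.
move=> a [x y]; congr pair => /=; first by rewrite !linearN !opprK dg_dh.
by rewrite linearN hom_h linearD -dg_dh addrACA addNr add0r.
Qed.

End Cone.

(* The Koszul algebra K(B,f) as a dg module over itself.  An element x stands
   for \sum_S x S eps_S, where eps_S is the product of the eps_j for j in S in
   increasing order, of degree - #|S|; [sgn j S] is the sign of moving eps_j
   past the factors of eps_S of smaller index. *)
Definition koszul_car : lmodType B := {ffun {set 'I_n} -> B^o}.

Definition sgn (j : 'I_n) (S : {set 'I_n}) : B :=
  (-1) ^+ #|[set i in S | (i < j)%N]|.

Definition koszul_pr (i : int) (x : koszul_car) : koszul_car :=
  [ffun S : {set 'I_n} => if - (#|S|%:Z) == i then x S else 0].
Definition koszul_d (x : koszul_car) : koszul_car :=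
  [ffun S : {set 'I_n} => \sum_(j in ~: S) sgn j S * (f j * x (j |: S))].
Definition koszul_h (a : 'I_n) (x : koszul_car) : koszul_car :=
  [ffun S : {set 'I_n} => if a \in S then sgn a S * x (S :\ a) else 0].

Lemma koszul_pr_linear i : linear (koszul_pr i).
Proof.
move=> c x y; apply/ffunP => S; rewrite !ffunE.
by case: eqP => // _; rewrite scaler0 addr0.
Qed.

Lemma koszul_d_linear : linear koszul_d.
Proof.
move=> c x y; apply/ffunP => S; rewrite !ffunE scaler_sumr -big_split /=.
apply: eq_bigr => j _; rewrite !ffunE !mulrDr; congr (_ + _).
by rewrite /GRing.scale /= (mulrCA (f j) c) (mulrCA (sgn j S) c).
Qed.

Lemma koszul_h_linear a : linear (koszul_h a).
Proof.
move=> c x y; apply/ffunP => S; rewrite !ffunE.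
case: (a \in S); last by rewrite scaler0 addr0.
by rewrite mulrDr /GRing.scale /= mulrCA.
Qed.

HB.instance Definition _ i :=
  GRing.isLinear.Build B koszul_car koszul_car *:%R (koszul_pr i)
    (koszul_pr_linear i).
HB.instance Definition _ :=
  GRing.isLinear.Build B koszul_car koszul_car *:%R koszul_d koszul_d_linear.
HB.instance Definition _ a :=
  GRing.isLinear.Build B koszul_car koszul_car *:%R (koszul_h a)
    (koszul_h_linear a).

Lemma sgnU j k (S : {set 'I_n}) : j \notin S ->
  sgn k (j |: S) = (-1) ^+ (j < k)%N * sgn k S.
Proof.
move=> jS; rewrite /sgn -exprD; congr (_ ^+ _).
rewrite (cardsD1 j) !inE eqxx /=; congr (_ + _)%N; apply: eq_card => i.
by rewrite !inE; case: eqP => //= ->; rewrite (negPf jS).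
Qed.

Lemma sgnD j k (S : {set 'I_n}) : j \in S ->
  sgn k S = (-1) ^+ (j < k)%N * sgn k (S :\ j).
Proof. by move=> jS; rewrite -{1}(setD1K jS) sgnU // !inE eqxx. Qed.

Lemma sgnK k (S : {set 'I_n}) : sgn k S * sgn k S = 1.
Proof. by rewrite /sgn -expr2 sqrr_sign. Qed.

Lemma sgn_neq (j k : 'I_n) : j != k ->
  (-1) ^+ (k < j)%N = - (-1) ^+ (j < k)%N :> B.
Proof.
move=> jk; have /orP[lt|lt]: (j < k)%N || (k < j)%N by rewrite -neq_ltn.
  by rewrite lt ltnNge (ltnW lt) /= expr0 expr1 opprK.
by rewrite lt ltnNge (ltnW lt) /= expr0 expr1.
Qed.

Lemma sum_anti (G : 'I_n -> 'I_n -> B) :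
  (forall j, G j j = 0) -> (forall j k, j != k -> G j k = - G k j) ->
  \sum_j \sum_k G j k = 0.
Proof.
move=> G0 GN.
have E j : \sum_k G j k =
    \sum_(k : 'I_n | (j < k)%N) G j k + \sum_(k : 'I_n | (k < j)%N) G j k.
  rewrite (bigID (fun k : 'I_n => (j < k)%N)) /=; congr (_ + _).
  rewrite (bigID (fun k : 'I_n => (k < j)%N)) /= [X in _ + X]big1 ?addr0.
    by apply: eq_bigl => k; rewrite -leqNgt; case: ltngtP.
  by move=> k; rewrite -!leqNgt -eqn_leq => /eqP/val_inj ->.
under eq_bigr do rewrite E.
rewrite big_split /= [X in _ + X](exchange_big_dep xpredT) //= -big_split.
rewrite big1 // => j _; rewrite -big_split big1 // => k jk /=.
by rewrite GN ?addNr // -val_eqE neq_ltn jk.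
Qed.

Program Definition koszul : dgmod f :=
  @DgMod B n f koszul_car koszul_pr koszul_d koszul_h _ _ _ _ _ _ _ _.
Next Obligation.
move=> i j x; apply/ffunP => S; rewrite !ffunE.
have [<-|ij] := eqVneq i j; rewrite !ffunE; first by case: eqP.
by case: eqP => // ->; rewrite (negPf ij).
Qed.
Next Obligation.
move=> x; exists [seq - (k%:Z) | k <- iota 0 n.+1].
  by rewrite map_inj_uniq ?iota_uniq // => i j /oppr_inj [].
apply/ffunP => S; rewrite big_map sum_ffunE.
rewrite (bigD1_seq #|S|) ?iota_uniq //; last first.
  by have := max_card (mem S); rewrite card_ord mem_iota add0n ltnS.
rewrite ffunE eqxx big1 /= ?addr0 // => k kS; rewrite ffunE.
by rewrite (inj_eq oppr_inj) eqz_nat eq_sym (negPf kS).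
Qed.
Next Obligation.
move=> i x; apply/ffunP => S; rewrite !ffunE.
have E j : j \in ~: S ->
    (- (#|j |: S|%:Z) == i) = (- (#|S|%:Z) == i + 1).
  rewrite inE => jS; rewrite cardsU1 jS add1n -addn1 PoszD opprD.
  by rewrite subr_eq.
case: eqP => eS.
  apply: eq_bigr => j jS; rewrite ffunE E //.
  by rewrite eS eqxx.
by rewrite big1 // => j jS; rewrite ffunE E //; case: eqP => // _; rewrite !mulr0.
Qed.
Next Obligation.
move=> a i x; apply/ffunP => S; rewrite !ffunE.
case: (boolP (a \in S)) => aS; last by rewrite if_same.
have -> : (- (#|S :\ a|%:Z) == i) = (- (#|S|%:Z) == i - 1).
  by rewrite (cardsD1 a S) aS add1n -addn1 PoszD opprD (inj_eq (addIr _)).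
by case: eqP => // _; rewrite mulr0.
Qed.
Next Obligation.
move=> x; apply/ffunP => S; rewrite !ffunE.
pose G j k := if (j \notin S) && (k \notin S) && (j != k) then
  sgn j S * (f j * (sgn k (j |: S) * (f k * x (k |: (j |: S))))) else 0.
rewrite (_ : \sum_(_ in _) _ = \sum_j \sum_k G j k).
  apply: sum_anti => [j|j k jk]; first by rewrite /G eqxx andbF.
  rewrite /G (eq_sym k) (andbC (k \notin S)).
  case: ifP => [/andP[/andP[jS kS] _]|_]; last by rewrite oppr0.
  rewrite setUCA !sgnU // (sgn_neq jk).
  rewrite !mulNr !mulrN opprK.
  by rewrite [LHS](AC (1*(1*(2*2))) (4*(5*((3*1)*(2*6))))).
rewrite big_mkcond; apply: eq_bigr => j _ /=; rewrite inE.
case: (boolP (j \in S)) => jS /=.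
  by rewrite big1 // => k _; rewrite /G jS.
rewrite ffunE !mulr_sumr big_mkcond; apply: eq_bigr => k _ /=.
by rewrite /G jS !inE negb_or eq_sym andbC.
Qed.
Next Obligation.
move=> a x; apply/ffunP => S; rewrite !ffunE.
by rewrite setD11 mulr0 if_same.
Qed.
Next Obligation.
move=> a b x; apply/ffunP => S; rewrite !ffunE !inE.
have [->|ab] := eqVneq a b; first by rewrite /= mulr0 if_same addr0.
case: (boolP (a \in S)) => aS; case: (boolP (b \in S)) => bS /=;
  rewrite ?mulr0 ?addr0 //.
rewrite (sgnD a bS) (sgnD b aS) (sgn_neq ab) !setDDl (setUC [set b]).
by rewrite [X in _ + X](AC (2*2) ((1*3)*(2*4))) /= !mulNr mulrA addNr.
Qed.
Next Obligation.
move=> a x; apply/ffunP => S; rewrite !ffunE.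
have [aS|aS] := boolP (a \in S); last first.
  rewrite addr0 (bigD1 a) ?inE //= ffunE setU11 setU1K // sgnU //.
  rewrite ltnn mul1r mulrCA (mulrA (sgn a S)) sgnK mul1r big1 ?addr0 // => j /andP[_ ja].
  by rewrite ffunE !inE eq_sym (negPf ja) (negPf aS) !mulr0.
rewrite [X in _ + _ * X](bigD1 a) /=; last by rewrite !inE eqxx.
have sDa : sgn a S = sgn a (S :\ a) by rewrite (sgnD a aS) ltnn mul1r.
rewrite mulrDr (mulrA (sgn a S)) sDa sgnK mul1r setD1K // addrCA.
rewrite -[RHS]addr0; congr (_ + _).
rewrite mulr_sumr [X in _ + X](eq_bigl (fun j => j \in ~: S)); last first.
  by move=> j; rewrite !inE; have [->|_] := eqVneq j a; rewrite ?aS ?andbT.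
rewrite -big_split big1 //= => j; rewrite inE => jS.
have ja : j != a by apply: contraNneq jS => ->.
rewrite ffunE !inE aS orbT sgnU // (sgnD j aS) sDa.
have -> : (j |: S) :\ a = j |: (S :\ a).
  by apply/setP => i; rewrite !inE; case: (eqVneq i j) => [->|]; rewrite ?ja.
rewrite (sgn_neq ja).
rewrite !mulNr [X in - X + _](AC (2*(1*(2*1))) ((1*4)*(5*(2*(3*6))))) /=.
by rewrite -expr2 sqrr_sign mul1r addNr.
Qed.

(* Perf(K(B,f)), as the thick subcategory generated by K(B,f) in its derived
   category. *)
Inductive perfect : dgmod f -> Prop :=
| perfect_koszul : perfect koszul
| perfect_shift E : perfect E -> perfect (shift E)
| perfect_unshift E : perfect (shift E) -> perfect E
| perfect_cone E F (u : dghom E F) :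
    perfect E -> perfect F -> perfect (cone u)
| perfect_retract E F (i : dghom E F) (r : dghom F E) :
    homotopic (hom_comp r i) (hom_id E) -> perfect F -> perfect E
| perfect_qis_src E F (u : dghom E F) : quasi_iso u -> perfect F -> perfect E
| perfect_qis_tgt E F (u : dghom E F) : quasi_iso u -> perfect E -> perfect F.

(* Coh^b: the cohomology is bounded, and finitely generated over B in each
   degree (equivalently over H^0(K(B,f)) = B/(f)). *)
Definition coh_bounded E : Prop :=
  (exists N : nat, forall i x, N%:Z < `|i| -> dg_pr E i x = x ->
     dg_d E x = 0 -> exists y, x = dg_d E y) /\
  (forall i, exists k (z : 'I_k -> E),
     (forall j, dg_pr E i (z j) = z j /\ dg_d E (z j) = 0) /\
     (forall x, dg_pr E i x = x -> dg_d E x = 0 ->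
        exists (c : 'I_k -> B) y, x = \sum_(j < k) c j *: z j + dg_d E y)).

(* Each component E_i is a direct summand of a finite free B-module. *)
Definition strictly_perfect E : Prop :=
  (exists N : nat, forall i x, N%:Z < `|i| -> dg_pr E i x = 0) /\
  (forall i, exists k (s : {linear E -> 'rV[B]_k}) (p : {linear 'rV[B]_k -> E}),
     (forall v, dg_pr E i (p v) = p v) /\
     (forall x, dg_pr E i x = x -> p (s x) = x)).

Definition concentrated_in (m m' : int) E : Prop :=
  forall i x, ~~ (m <= i <= m') -> dg_pr E i x = 0.

(* Morphisms E -> F of the Verdier quotient Coh^b / Perf, as roofs
   E <- apex -> F of closed maps whose left leg has a perfect cone.  Acyclic
   modules are perfect, so that quasi-isomorphisms are inverted too and one may
   start from the homotopy category of dg modules; and when E is in Coh^b and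
   the left leg has a perfect cone, so is the apex. *)
Record roof E F := Roof {
  roof_apex : dgmod f;
  roof_den : dghom roof_apex E;
  roof_num : dghom roof_apex F
}.

Definition roof_ok E F (r : roof E F) : Prop := perfect (cone (roof_den r)).

Definition roof_of_hom E F (u : dghom E F) : roof E F := Roof (hom_id E) u.

Definition roof_eq E F (r r' : roof E F) : Prop :=
  exists Q (u : dghom Q (roof_apex r)) (u' : dghom Q (roof_apex r')),
    [/\ homotopic (hom_comp (roof_den r) u) (hom_comp (roof_den r') u'),
        homotopic (hom_comp (roof_num r) u) (hom_comp (roof_num r') u')
      & perfect (cone (hom_comp (roof_den r) u))].

(* [roof_comp r2 r1 r]: the composite r2 o r1 equals r in Coh^b / Perf. *)
Definition roof_comp E F G (r2 : roof F G) (r1 : roof E F) (r : roof E G) :=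
  exists Q (u : dghom Q (roof_apex r1)) (v : dghom Q (roof_apex r2)),
    [/\ perfect (cone u),
        homotopic (hom_comp (roof_num r1) u) (hom_comp (roof_den r2) v)
      & roof_eq (Roof (hom_comp (roof_den r1) u) (hom_comp (roof_num r2) v)) r].

(* Quotients are taken in dgCat^idm: the homotopy category of Sing is the
   idempotent completion of the Verdier quotient, with objects the pairs
   (E, e), e an idempotent endomorphism of E, which is also the identity of
   (E, e). *)
Record sing_ob := SingOb {
  sing_mod : dgmod f;
  sing_idem : roof sing_mod sing_mod
}.

Definition is_sing_ob (X : sing_ob) : Prop :=
  [/\ coh_bounded (sing_mod X), roof_ok (sing_idem X)
    & roof_comp (sing_idem X) (sing_idem X) (sing_idem X)].

Definition is_sing_hom (X Y : sing_ob) (a : roof (sing_mod X) (sing_mod Y)) :=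
  [/\ roof_ok a, roof_comp a (sing_idem X) a & roof_comp (sing_idem Y) a a].

Definition sing_retract (X Y : sing_ob) : Prop :=
  exists (a : roof (sing_mod X) (sing_mod Y))
         (b : roof (sing_mod Y) (sing_mod X)),
    [/\ is_sing_hom a, is_sing_hom b & roof_comp b a (sing_idem X)].

Definition sing_iso (X Y : sing_ob) : Prop :=
  exists (a : roof (sing_mod X) (sing_mod Y))
         (b : roof (sing_mod Y) (sing_mod X)),
    [/\ is_sing_hom a, is_sing_hom b, roof_comp b a (sing_idem X)
      & roof_comp a b (sing_idem Y)].

Definition sing_zero (X : sing_ob) : Prop :=
  roof_eq (sing_idem X) (roof_of_hom (hom_zero (sing_mod X) (sing_mod X))).

Definition sing_of (E : dgmod f) : sing_ob := SingOb (roof_of_hom (hom_id E)).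

End DgModules.

(* The pushforward i_* along X_0 -> X = Spec B: forget the h^a.  Over X we use
   the same notions for the empty sequence of functions, for which K = B. *)
Definition nofun (B : comPzRingType) (i : 'I_0) : B := 0.
Arguments nofun B i : clear implicits.

Section Pushforward.

Variables (B : comPzRingType) (n : nat) (f : 'I_n -> B).

Definition push (E : dgmod f) : dgmod (nofun B) :=
  @DgMod B 0 (nofun B) E (dg_pr E) (dg_d E) (fun _ => \0)
    (@dg_prK _ _ _ E) (@dg_sum _ _ _ E) (@dg_d_pr _ _ _ E)
    (fun a => False_ind _ (notF (ltn_ord a))) (@dg_dd _ _ _ E)
    (fun a => False_ind _ (notF (ltn_ord a)))
    (fun a => False_ind _ (notF (ltn_ord a)))
    (fun a => False_ind _ (notF (ltn_ord a))).

Definition push_hom (E F : dgmod f) (u : dghom E F) : dghom (push E) (push F) :=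
  @DgHom B 0 (nofun B) (push E) (push F) u (hom_pr u) (hom_d u)
    (fun a => False_ind _ (notF (ltn_ord a))).

Definition push_roof (E F : dgmod f) (r : roof E F) : roof (push E) (push F) :=
  Roof (push_hom (roof_den r)) (push_hom (roof_num r)).

Definition push_ob (X : sing_ob f) : sing_ob (nofun B) :=
  SingOb (push_roof (sing_idem X)).

(* Sing(B,f) is the fiber of i_* : Sing(X_0) -> Sing(X) over 0, i.e. the full
   subcategory of Sing(X_0) on the objects with zero image. *)
Definition is_relsing_ob (X : sing_ob f) : Prop :=
  is_sing_ob X /\ sing_zero (push_ob X).

End Pushforward.

(* Main.v *)
(* Write [weq u] for "the cone of u is perfect over K = K(B,f)".  Let X = (E, e)
   be an object of Sing(B,f).  In Coh^b/Perf the cone C1 of 1 - e is X + X[1], so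
   X is a retract of C1, and the push-forward of C1 to B is perfect because e
   becomes 0 there.  This removes
   the idempotent.

   Now let E be coherent over K and perfect over B, truncated below.  Killing
   its cohomology from the top by free cells yields P -> E with P perfect over K
   and C = cone(P -> E) concentrated in degrees >= c with cohomology in degrees
   [c, c+n]: the n extra degrees are those of K itself.  Thus E -> C is a [weq].
   Approximating C once more by a semi-free G -> C with generators in degrees
   <= c+n, the truncation T = tau_{>=c} G is quasi-isomorphic to C and lives in
   degrees [c, c+n].  Its terms above c are free.  The bottom term
   G^c / d G^{c-1} is projective: if c is small enough, C is quasi-isomorphic
   over B to a bounded complex S of projectives in degrees >= c, and the
   comparison maps G -> S -> G, corrected by a homotopy defined in degrees >= c
   only, give a splitting of G^c -> G^c / d G^{c-1}. *)

Require Import Defs.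
From HB Require Import structures.
From mathcomp Require Import all_boot all_order all_algebra zify.
From Stdlib Require Import ClassicalEpsilon FunctionalExtensionality PropExtensionality.
From Stdlib Require Import Setoid Morphisms.

Set Implicit Arguments.
Unset Strict Implicit.
Unset Printing Implicit Defensive.

Import Order.TTheory GRing.Theory Num.Theory.
Local Open Scope ring_scope.

#[local] Obligation Tactic := idtac.

(* [zmod] proves the identities valid in all abelian groups; [zlin H] proves
   x = y when x - y and the difference of the two sides of H agree by [zmod]. *)
Inductive zexp := ZZero | ZVar of nat | ZAdd of zexp & zexp | ZOpp of zexp.

Fixpoint zeval (V : zmodType) (env : seq V) (e : zexp) : V :=
  match e with
  | ZZero => 0
  | ZVar i => env`_i
  | ZAdd a b => zeval env a + zeval env b
  | ZOpp a => - zeval env a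
  end.

Fixpoint zcoef (e : zexp) (i : nat) : int :=
  match e with
  | ZZero => 0
  | ZVar j => (i == j)%:R
  | ZAdd a b => zcoef a i + zcoef b i
  | ZOpp a => - zcoef a i
  end.

Lemma zeval_coef (V : zmodType) (env : seq V) e :
  zeval env e = \sum_(i < size env) env`_i *~ zcoef e i.
Proof.
elim: e => [|j|a IHa b IHb|a IHa] /=; rewrite ?IHa ?IHb.
- by rewrite big1 // => i _; rewrite mulr0z.
- have [lt|ge] := ltnP j (size env); last first.
    rewrite nth_default // big1 // => i _; case: eqP => [eij|]; last by rewrite mulr0z.
    by move: ge; rewrite -eij leqNgt ltn_ord.
  rewrite (bigD1 (Ordinal lt)) //= eqxx mulr1z big1 ?addr0 // => i.
  by rewrite -val_eqE /= => /negPf ->; rewrite mulr0z.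
- by rewrite -big_split; apply: eq_bigr => i _; rewrite mulrzDr.
- by rewrite -sumrN; apply: eq_bigr => i _; rewrite mulrNz.
Qed.

Lemma zeval_eq (V : zmodType) (env : seq V) k e1 e2 :
  size env = k -> all (fun i => zcoef e1 i == zcoef e2 i) (iota 0 k) ->
  zeval env e1 = zeval env e2.
Proof.
move=> <- /allP H; rewrite !zeval_coef; apply: eq_bigr => i _.
by rewrite (eqP (H i _)) // mem_iota ltn_ord.
Qed.

Ltac z_index x env :=
  match env with
  | cons ?y _ => let h := match constr:(Set) with _ => unify x y end in constr:(0%N)
  | cons _ ?env' => let i := z_index x env' in constr:(i.+1)
  end.
Ltac z_vars t env :=
  match t with
  | @Algebra.zero _ => env
  | @Algebra.add _ ?a ?b => let env' := z_vars a env in z_vars b env'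
  | @Algebra.opp _ ?a => z_vars a env
  | _ => match constr:(Set) with
         | _ => let i := z_index t env in env
         | _ => constr:(cons t env)
         end
  end.
Ltac z_reify t env :=
  match t with
  | @Algebra.zero _ => constr:(ZZero)
  | @Algebra.add _ ?a ?b =>
      let ea := z_reify a env in let eb := z_reify b env in constr:(ZAdd ea eb)
  | @Algebra.opp _ ?a => let ea := z_reify a env in constr:(ZOpp ea)
  | _ => let i := z_index t env in constr:(ZVar i)
  end.
Ltac zmod :=
  match goal with
  | |- @eq ?T ?a ?b =>
    let env := z_vars a (@nil T) in
    let env := z_vars b env in
    let ea := z_reify a env in
    let eb := z_reify b env in
    refine (@zeval_eq _ env _ ea eb erefl _); by vm_compute
  end.

Section Zlin.
Variable V : zmodType.
Implicit Types a b c d x y : V.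

Lemma addeq a b c d : a = b -> c = d -> a + c = b + d.
Proof. by move=> -> ->. Qed.

Lemma oppeq a b : a = b -> - a = - b.
Proof. by move=> ->. Qed.

Lemma zlin_subproof a b x y : a = b -> x - y = a - b -> x = y.
Proof. by move=> -> /eqP; rewrite subrr subr_eq0 => /eqP. Qed.
End Zlin.

Ltac zlin H := refine (zlin_subproof H _); zmod.

Definition mklin (B : comPzRingType) (U V : lmodType B) (g : U -> V)
    (gl : linear g) : {linear U -> V} :=
  HB.pack g (GRing.isLinear.Build B U V *:%R g gl).

(* Rewriting with the generic [linearN] loops, as the opposite is itself linear;
   [expand] uses instances at fixed maps. *)
Section Expand.
Variables (B : comPzRingType) (n : nat) (f : 'I_n -> B) (E F : dgmod f).

Lemma linE (U V : lmodType B) (u : {linear U -> V}) :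
  [/\ u 0 = 0, forall x y, u (x + y) = u x + u y, forall x, u (- x) = - u x
    & forall c x, u (c *: x) = c *: u x].
Proof. by split=> *; rewrite ?linear0 ?linearD ?linearN ?linearZZ. Qed.

Definition dg_dE := let: And4 a b c d := linE (dg_d E) in (a, b, c, d).
Definition dg_hE a := let: And4 x b c d := linE (dg_h E a) in (x, b, c, d).
Definition dg_prE i := let: And4 a b c d := linE (dg_pr E i) in (a, b, c, d).
Definition homE (u : dghom E F) := let: And4 a b c d := linE u in (a, b, c, d).
End Expand.

Definition scaleE (B : comPzRingType) (V : lmodType B) :=
  (@scalerDr B V, @scalerN B V, @scaler0 B V).

Ltac expand := rewrite /= ?(dg_dE, dg_hE, dg_prE, homE, scaleE) /=.
Ltac expandw s := rewrite /= ?(linearD s, linearN s, linear0 s, linearZZ s) /=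
  ?(dg_dE, dg_hE, dg_prE, homE, scaleE) /=.

(** * Homotopies and cohomology *)

Section Homs.

Variables (B : comPzRingType) (n : nat) (f : 'I_n -> B).
Implicit Types E F G : dgmod f.

Definition mkhom E F (g : E -> F) (gl : linear g)
    (gp : forall i x, g (dg_pr E i x) = dg_pr F i (g x))
    (gd : forall x, g (dg_d E x) = dg_d F (g x))
    (gh : forall a x, g (dg_h E a x) = dg_h F a (g x)) : dghom E F :=
  @DgHom B n f E F (mklin gl) gp gd gh.

Lemma homotopicI E F (u v : dghom E F) (s : E -> F) : linear s ->
  (forall i x, s (dg_pr E i x) = dg_pr F (i - 1) (s x)) ->
  (forall a x, s (dg_h E a x) = - dg_h F a (s x)) ->
  (forall x, u x - v x = dg_d F (s x) + s (dg_d E x)) -> homotopic u v.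
Proof. by move=> sl *; exists (mklin sl). Qed.

Program Definition hom_sub E F (u v : dghom E F) : dghom E F :=
  @DgHom B n f E F (u \- v) _ _ _.
Next Obligation. by move=> E F u v i x /=; rewrite !hom_pr linearB. Qed.
Next Obligation. by move=> E F u v x /=; rewrite !hom_d linearB. Qed.
Next Obligation. by move=> E F u v a x /=; rewrite !hom_h linearB. Qed.

Lemma homotopic_ext E F (u v : dghom E F) : u =1 v -> homotopic u v.
Proof.
move=> uv; apply: (@homotopicI _ _ _ _ (fun=> 0)) => [c x y|i x|a x|x].
- by rewrite scaler0 addr0.
- by rewrite linear0.
- by rewrite linear0 oppr0.
- by rewrite uv subrr linear0 addr0.
Qed.

Lemma homotopic_refl E F (u : dghom E F) : homotopic u u.
Proof. exact: homotopic_ext. Qed.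

Lemma homotopic_sym E F (u v : dghom E F) : homotopic u v -> homotopic v u.
Proof.
case=> s [sp sh sd]; apply: (@homotopicI _ _ _ _ (fun x => - s x)).
- by move=> c x y; expandw s; zmod.
- by move=> i x; rewrite sp linearN.
- by move=> a x; rewrite sh; expand.
- by move=> x; expand; zlin (oppeq (sd x)).
Qed.

Lemma homotopic_trans E F (v u w : dghom E F) :
  homotopic u v -> homotopic v w -> homotopic u w.
Proof.
case=> s [sp sh sd] [t [tp th td]].
apply: (@homotopicI _ _ _ _ (fun x => s x + t x)).
- by move=> c x y; expandw s; expandw t; zmod.
- by move=> i x; rewrite sp tp linearD.
- by move=> a x; rewrite sh th linearD opprD.
- by move=> x; expand; zlin (addeq (sd x) (td x)).
Qed.

Lemma homotopic_compl E F G (w : dghom F G) (u v : dghom E F) :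
  homotopic u v -> homotopic (hom_comp w u) (hom_comp w v).
Proof.
case=> s [sp sh sd]; apply: (@homotopicI _ _ _ _ (fun x => w (s x))).
- by move=> c x y; expandw s.
- by move=> i x; rewrite sp hom_pr.
- by move=> a x; rewrite sh; expand; rewrite hom_h.
- by move=> x; rewrite /= -hom_d -linearB sd linearD.
Qed.

Lemma homotopic_compr E F G (u v : dghom F G) (w : dghom E F) :
  homotopic u v -> homotopic (hom_comp u w) (hom_comp v w).
Proof.
case=> s [sp sh sd]; apply: (@homotopicI _ _ _ _ (fun x => s (w x))).
- by move=> c x y; expand; expandw s.
- by move=> i x; rewrite hom_pr sp.
- by move=> a x; rewrite hom_h sh.
- by move=> x; rewrite /= hom_d -sd.
Qed.

Lemma homotopic_sub E F (u u' v v' : dghom E F) :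
  homotopic u u' -> homotopic v v' -> homotopic (hom_sub u v) (hom_sub u' v').
Proof.
case=> s [sp sh sd] [t [tp th td]].
apply: (@homotopicI _ _ _ _ (fun x => s x - t x)).
- by move=> c x y; expandw s; expandw t; zmod.
- by move=> i x; rewrite sp tp linearB.
- by move=> a x; rewrite sh th; expand; zmod.
- by move=> x; expand; zlin (addeq (sd x) (oppeq (td x))).
Qed.

Lemma homotopic_sub0 E F (u v : dghom E F) :
  homotopic u v <-> homotopic (hom_sub u v) (hom_zero E F).
Proof.
by split=> -[s [sp sh sd]]; exists s; split=> // x; have := sd x; rewrite /= subr0.
Qed.

Definition acyclic E : Prop := forall x, dg_d E x = 0 -> exists y, x = dg_d E y.

Definition hzero E (i : int) : Prop :=
  forall x, dg_pr E i x = x -> dg_d E x = 0 -> exists y, x = dg_d E y.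

Definition hgen E (i : int) (k : nat) : Prop :=
  exists z : 'I_k -> E,
    (forall j, dg_pr E i (z j) = z j /\ dg_d E (z j) = 0) /\
    (forall x, dg_pr E i x = x -> dg_d E x = 0 ->
       exists (c : 'I_k -> B) y, x = \sum_(j < k) c j *: z j + dg_d E y).

Lemma hgen0 E i : hgen E i 0 <-> hzero E i.
Proof.
split=> [[z [_ H]] x px dx|H].
  by have [c [y ->]] := H x px dx; exists y; rewrite big_ord0 add0r.
exists (fun=> 0); split=> [j|x px dx]; first by case: j.
have [y ->] := H x px dx; exists (fun=> 0), y.
by rewrite big_ord0 add0r.
Qed.

Lemma dg_prid E i x : dg_pr E i (dg_pr E i x) = dg_pr E i x.
Proof. by rewrite dg_prK eqxx. Qed.

Lemma dg_pr_neq E i j x : dg_pr E j x = x -> i != j -> dg_pr E i x = 0.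
Proof. by move=> <- ij; rewrite dg_prK (negPf ij). Qed.

Lemma dg_prd E i x : dg_pr E i x = x -> dg_pr E (i + 1) (dg_d E x) = dg_d E x.
Proof. by move=> px; rewrite -dg_d_pr px. Qed.

Lemma homog_eq E (V : lmodType B) (u v : {linear E -> V}) :
  (forall i x, dg_pr E i x = x -> u x = v x) -> u =1 v.
Proof.
move=> H x; have [s us {1 2}->] := dg_sum x.
by rewrite !linear_sum; apply: eq_bigr => i _; apply: (H i); rewrite dg_prid.
Qed.

Lemma pr_ext E (x y : E) : (forall i, dg_pr E i x = dg_pr E i y) -> x = y.
Proof.
move=> H; apply/eqP; rewrite -subr_eq0; apply/eqP.
have [s us ->] := dg_sum (x - y).
by rewrite big1 // => i _; rewrite linearB H subrr.
Qed.

Lemma acyclicP E : acyclic E <-> forall i, hzero E i.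
Proof.
split=> [H i x _|H x dx]; first exact: H.
have [s us ->] := dg_sum x; elim: s {us} => [|i s [y IH]].
  by exists 0; rewrite big_nil linear0.
have [||z zE] := H i (dg_pr E i x); first by rewrite dg_prid.
  by rewrite dg_d_pr dx linear0.
by exists (z + y); rewrite big_cons linearD IH zE.
Qed.

Lemma hzero_pr E i : hzero E i -> forall x, dg_pr E i x = x -> dg_d E x = 0 ->
  exists2 y, dg_pr E (i - 1) y = y & x = dg_d E y.
Proof.
move=> H x px dx; have [y xE] := H x px dx.
exists (dg_pr E (i - 1) y); first exact: dg_prid.
by rewrite dg_d_pr subrK -xE px.
Qed.

End Homs.

Ltac pairs H H1 H2 := have H1 := congr1 fst H; have H2 := congr1 snd H;
  rewrite /= in H1 H2.

(** * Cones *)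

Section Cones.

Variables (B : comPzRingType) (n : nat) (f : 'I_n -> B).
Implicit Types E F G D : dgmod f.

Program Definition unshift E : dgmod f :=
  @DgMod B n f E (fun i => dg_pr E (i - 1)) (\- dg_d E)
    (fun a => \- dg_h E a) _ _ _ _ _ _ _ _.
Next Obligation.
by move=> E i j x /=; rewrite dg_prK (inj_eq (addIr _)).
Qed.
Next Obligation.
move=> E x; have [s us {1}->] := dg_sum x.
exists [seq i + 1 | i <- s]; first by rewrite map_inj_uniq //; apply: addIr.
by rewrite big_map; apply: eq_bigr => i _ /=; rewrite addrK.
Qed.
Next Obligation. by move=> E i x; expand; rewrite dg_d_pr addrAC. Qed.
Next Obligation. by move=> E a i x; expand; rewrite dg_h_pr. Qed.
Next Obligation. by move=> E x; expand; rewrite dg_dd !oppr0. Qed.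
Next Obligation. by move=> E a x; expand; rewrite dg_hh !oppr0. Qed.
Next Obligation. by move=> E a b x; expand; rewrite !opprK dg_hC. Qed.
Next Obligation. by move=> E a x; expand; rewrite !opprK dg_dh. Qed.

Program Definition unshiftK E : dghom (shift (unshift E)) E :=
  @DgHom B n f (shift (unshift E)) E idfun _ _ _.
Next Obligation. by move=> E i x /=; rewrite addrK. Qed.
Next Obligation. by move=> E x /=; rewrite opprK. Qed.
Next Obligation. by move=> E a x /=; rewrite opprK. Qed.

Definition shift_hom E F (u : dghom E F) : dghom (shift E) (shift F).
Proof.
apply: (@mkhom B n f (shift E) (shift F) u) => [c x y|i x|x|a x].
- by expand.
- by rewrite /= hom_pr.
- by expand; rewrite hom_d.
- by expand; rewrite hom_h.
Defined.

Definition unshift_hom E F (u : dghom E (shift F)) : dghom (unshift E) F.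
Proof.
apply: (@mkhom B n f (unshift E) F u) => [c x y|i x|x|a x].
- by expand.
- by rewrite /= hom_pr /= subrK.
- by expand; rewrite hom_d /= opprK.
- by expand; rewrite hom_h /= opprK.
Defined.

Definition jcone E F (u : dghom E F) : dghom F (cone u).
Proof.
apply: (@mkhom B n f F (cone u) (fun y => (0, y))) => [c x y|i x|x|a x].
- by congr pair; expand; rewrite ?addr0.
- by congr pair; expand.
- by congr pair; expand; rewrite ?oppr0 ?add0r.
- by congr pair; expand; rewrite ?oppr0.
Defined.

Definition pcone E F (u : dghom E F) : dghom (cone u) (shift E).
Proof.
apply: (@mkhom B n f (cone u) (shift E) fst) => [c [x y] [x' y']|i [x y]|[x y]|a [x y]].
- by [].
- by [].
- by [].
- by [].
Defined.

Section ConeMap.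
Variables (E F E' F' : dgmod f) (u : dghom E F) (u' : dghom E' F').
Variables (a : dghom E E') (b : dghom F F').

Definition cone_map_fun (k : {linear E -> F'}) (z : E * F) : E' * F' :=
  (a z.1, b z.2 + k z.1).

Lemma cone_map : homotopic (hom_comp b u) (hom_comp u' a) ->
  exists (k : {linear E -> F'}) (c : dghom (cone u) (cone u')),
    (forall x, b (u x) - u' (a x) = dg_d F' (k x) + k (dg_d E x)) /\
    c =1 cone_map_fun k.
Proof.
case=> k [kp kh kd]; exists k.
have gl : linear (cone_map_fun k).
  by move=> c [x y] [x' y']; congr pair; expandw k; last zmod.
unshelve eexists (@mkhom B n f (cone u) (cone u') (cone_map_fun k) gl _ _ _) =>
    [i [x y]|[x y]|j [x y]|]; last by [].
- by congr pair; expandw k; rewrite hom_pr // kp addrK.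
- congr pair; expandw k; rewrite hom_d //.
  by have /= H := kd x; zlin H.
- congr pair; expandw k; rewrite hom_h // kh; expand; zmod.
Qed.
End ConeMap.

Lemma cone_map_qis E F E' F' (u : dghom E F) (u' : dghom E' F')
    (a : dghom E E') (b : dghom F F') :
  homotopic (hom_comp b u) (hom_comp u' a) -> quasi_iso a -> quasi_iso b ->
  exists2 c : dghom (cone u) (cone u'), quasi_iso c & forall y, c (0, y) = (0, b y).
Proof.
move=> H [a1 a2] [b1 b2]; have [k [c [kd ck]]] := cone_map H.
exists c => [|y]; last by rewrite ck; congr pair; expandw k; rewrite ?addr0.
split=> [[x y] Hz [[p q] Hp]|[x y] Hz].
  pairs Hz Hx Hy; rewrite ck in Hp; pairs Hp Hp1 Hp2.
  have [||x0 xE] := a1 x; first by zlin (oppeq Hx).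
    by exists (- p); expand.
  have dax0 : dg_d E' (a x0) = a x by rewrite xE hom_d.
  have [|x1 [x2 [dx1 px1]]] := a2 (p + a x0).
    by expand; rewrite dax0; zlin Hp1.
  have [||y0 y0E] := b1 (y + u x0 - u x1).
  - by expand; rewrite -!hom_d -xE dx1; expand; zlin Hy.
  - exists (q + k x0 - k x1 + u' x2); have kx0 := kd x0; have kx1 := kd x1.
    rewrite -xE in kx0; rewrite dx1 linear0 in kx1; have up := congr1 u' px1.
    move: up; expand; rewrite -hom_d => up.
    by zlin (addeq (addeq Hp2 (addeq kx0 (oppeq kx1))) up).
  exists (x1 - x0, y0); congr pair; expand.
  - by rewrite dx1 xE; zmod.
  - by zlin y0E.
pairs Hz Hx Hy.
have [|x1 [x2 [dx1 px1]]] := a2 x; first by zlin (oppeq Hx).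
have up := congr1 u' px1; have kx1 := kd x1; rewrite dx1 linear0 in kx1.
move: up; expand; rewrite hom_d => up.
have [||x3 x3E] := b1 (u x1).
- by rewrite -hom_d dx1 linear0.
- exists (k x1 - y - u' x2); expand.
  by zlin (addeq (addeq kx1 (oppeq up)) Hy).
have [|y1 [y2 [dy1 py1]]] := b2 (y + u' x2 - k x1 + b x3).
  expand; rewrite -(hom_d b) -x3E.
  by zlin (addeq (addeq kx1 (oppeq up)) Hy).
exists (x1, y1 - x3), (- x2, y2); split; rewrite ?ck; congr pair; expand.
- by rewrite dx1 oppr0.
- by rewrite dy1 -x3E; zmod.
- by zlin px1.
- by zlin py1.
Qed.

Definition cone_comp E F G (u : dghom E F) (v : dghom F G) :
  dghom (cone u) (cone (hom_comp v u)).
Proof.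
apply: (@mkhom B n f (cone u) (cone (hom_comp v u)) (fun z => (z.1, v z.2))) =>
    [c [x y] [x' y']|i [x y]|[x y]|j [x y]]; congr pair; expand => //.
- exact: hom_pr.
- by rewrite hom_d.
- exact: hom_h.
Defined.

Definition cone_comp_proj E F G (u : dghom E F) (v : dghom F G) :
  dghom (cone (cone_comp u v)) (cone v).
Proof.
apply: (@mkhom B n f (cone (cone_comp u v)) (cone v)
  (fun z => (z.1.2 + u z.2.1, z.2.2))) =>
    [c [[x y] [x' z]] [[x0 y0] [x'0 z0]]|i [[x y] [x' z]]|
     [[x y] [x' z]]|j [[x y] [x' z]]]; congr pair; expand => //.
- zmod.
- by rewrite hom_pr.
- by rewrite hom_d; zmod.
- zmod.
- by rewrite hom_h; zmod.
Defined.

(* The octahedral axiom. *)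
Lemma cone_comp_qis E F G (u : dghom E F) (v : dghom F G) :
  quasi_iso (cone_comp_proj u v).
Proof.
split=> [[[x y] [x' z]] H [[p q] H']|[y z] H].
  pairs H H0 H1; pairs H0 Hx Hy; pairs H1 Hx' Hz; pairs H' Hp Hq.
  exists ((x', p), (0, q)); congr pair; congr pair; expand.
  - by zlin Hx'.
  - by zlin Hp.
  - zmod.
  - by rewrite Hq; zmod.
pairs H Hy Hz.
exists ((0, y), (0, z)), 0; split; congr pair; expand; rewrite ?oppr0 ?addr0 //.
- congr pair; expand; first by rewrite !oppr0.
  by zlin Hy.
- congr pair; expand; first by zmod.
  by zlin Hz.
Qed.
End Cones.

(** * Two out of three *)

Section Thick.

Variables (B : comPzRingType) (n : nat) (f : 'I_n -> B).
Implicit Types E F G D : dgmod f.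

Definition jcone_proj E F (u : dghom E F) : dghom (cone (jcone u)) (shift E).
Proof.
apply: (@mkhom B n f (cone (jcone u)) (shift E) (fun z => z.2.1)) =>
  [c [y [x y']] [z [w z']]|i [y [x y']]|[y [x y']]|a [y [x y']]] //=.
by rewrite add0r.
Defined.

Lemma jcone_proj_qis E F (u : dghom E F) : quasi_iso (jcone_proj u).
Proof.
split=> [[y [x y']] H [x0 /= xE]|x H].
  pairs H Hy H1; pairs H1 Hx Hy'.
  exists (y' - u x0, (x0, 0)); congr pair; last congr pair; expand.
  - by rewrite -hom_d -(opprK (dg_d E x0)) -xE; expand; zlin Hy'.
  - by zlin xE.
  - zmod.
exists (- u x, (x, 0)), 0; split; last by expand; rewrite oppr0 addr0.
have dx : dg_d E x = 0 by move: H => /= H; zlin (oppeq H).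
congr pair; last congr pair; expand.
- by rewrite -hom_d dx linear0 oppr0 oppr0.
- by rewrite dx subr0.
- zmod.
Qed.

Definition pcone_proj E F (u : dghom E F) : dghom (cone (pcone u)) (shift F).
Proof.
apply: (@mkhom B n f (cone (pcone u)) (shift F) (fun z => z.1.2 + u z.2)) =>
  [c [[x y] z] [[x' y'] z']|i [[x y] z]|[[x y] z]|a [[x y] z]]; expand.
- zmod.
- by rewrite hom_pr.
- by rewrite hom_d; zmod.
- by rewrite hom_h; zmod.
Defined.

Lemma pcone_proj_qis E F (u : dghom E F) : quasi_iso (pcone_proj u).
Proof.
split=> [[[x y] z] H [y0 /= yE]|y /= H].
  pairs H H1 Hz; pairs H1 Hx Hy; move: yE => /= yE.
  exists ((z, y0), 0); congr pair; first congr pair; expand.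
  - by zlin Hz.
  - by zlin yE.
  - zmod.
exists ((0, y), 0), 0; split; last by expand; zmod.
have dy : dg_d F y = 0 by zlin (oppeq H).
by congr pair; first congr pair; expand; rewrite ?dy; zmod.
Qed.

Definition fib E D (u : dghom E D) := unshift (cone u).

Definition fibp E D (u : dghom E D) : dghom (fib u) E.
Proof.
apply: (@mkhom B n f (fib u) E fst) =>
  [c [x y] [x' y']|i [x y]|[x y]|a [x y]] //=; rewrite ?opprK //.
by rewrite subrK.
Defined.

Definition fib_proj E D (u : dghom E D) : dghom (cone (fibp u)) D.
Proof.
apply: (@mkhom B n f (cone (fibp u)) D (fun z => z.1.2 - u z.2)) =>
  [c [[x y] z] [[x' y'] z']|i [[x y] z]|[[x y] z]|a [[x y] z]]; expand.
- zmod.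
- by rewrite hom_pr addrK.
- by rewrite hom_d; zmod.
- by rewrite hom_h; zmod.
Defined.

Lemma fib_proj_qis E D (u : dghom E D) : quasi_iso (fib_proj u).
Proof.
split=> [[[x y] z] H [y0 /= yE]|y /= H].
  pairs H H1 Hz; pairs H1 Hx Hy; move: yE => /= yE.
  exists ((z, y0), 0); congr pair; first congr pair; expand.
  - by zlin Hz.
  - by zlin yE.
  - zmod.
exists ((0, y), 0), 0; split; last by expand; zmod.
by congr pair; first congr pair; expand; rewrite ?H; zmod.
Qed.

Lemma fib_null E D (u : dghom E D) : homotopic (hom_comp u (fibp u)) (hom_zero _ _).
Proof.
apply: (@homotopicI _ _ _ (fib u) D _ _ (fun z : E * D => - z.2)) =>
  [c [x y] [x' y']|i [x y]|a [x y]|[x y]]; expand => //; zmod.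
Qed.

Record thick (P : dgmod f -> Prop) : Prop := Thick {
  th_shift : forall E, P E -> P (shift E);
  th_unshift : forall E, P (shift E) -> P E;
  th_cone : forall E F (u : dghom E F), P E -> P F -> P (cone u);
  th_src : forall E F (u : dghom E F), quasi_iso u -> P F -> P E;
  th_tgt : forall E F (u : dghom E F), quasi_iso u -> P E -> P F
}.

Section TwoOfThree.
Variables (P : dgmod f -> Prop) (thP : thick P).

Lemma thick_tgt E F (u : dghom E F) : P E -> P (cone u) -> P F.
Proof.
move=> PE Pu; apply: (th_unshift thP); apply: th_tgt (pcone_proj_qis u) _ => //.
by apply: th_cone => //; apply: th_shift.
Qed.

Lemma thick_src E F (u : dghom E F) : P F -> P (cone u) -> P E.
Proof.
move=> PF Pu; apply: (th_unshift thP); apply: th_tgt (jcone_proj_qis u) _ => //.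
exact: th_cone.
Qed.

Lemma thick_unshift E : P E -> P (unshift E).
Proof.
move=> PE; apply: (th_unshift thP); apply: (@th_src _ thP _ _ (unshiftK E) _ PE).
split=> [x dx [y xE]|y dy].
  by exists y; rewrite /= opprK -xE.
by exists y, 0; split; rewrite /= ?opprK ?linear0 ?addr0.
Qed.

Lemma thick_comp E F G (u : dghom E F) (v : dghom F G) :
  P (cone u) -> P (cone v) -> P (cone (hom_comp v u)).
Proof.
move=> Pu Pv; apply: (@thick_tgt _ _ (cone_comp u v) Pu).
exact: th_src (cone_comp_qis u v) Pv.
Qed.

Lemma thick_cancell E F G (u : dghom E F) (v : dghom F G) :
  P (cone v) -> P (cone (hom_comp v u)) -> P (cone u).
Proof.
by move=> Pv Pvu; apply: (@thick_src _ _ (cone_comp u v) Pvu); apply: th_src (cone_comp_qis u v) Pv.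
Qed.

Lemma thick_cancelr E F G (u : dghom E F) (v : dghom F G) :
  P (cone u) -> P (cone (hom_comp v u)) -> P (cone v).
Proof.
by move=> Pu Pvu; apply: (th_tgt thP (cone_comp_qis u v)); apply: th_cone.
Qed.

Lemma quasi_iso_id E : quasi_iso (hom_id E).
Proof.
split=> [x _ [y xE]|y dy]; first by exists y.
by exists y, 0; rewrite linear0 addr0.
Qed.

Lemma thick_homotopic E F (u v : dghom E F) :
  homotopic u v -> P (cone u) -> P (cone v).
Proof.
move=> uv; have [|c cq _] := @cone_map_qis _ _ _ _ _ _ _ u v (hom_id E) (hom_id F) _
  (quasi_iso_id E) (quasi_iso_id F); first exact: uv.
exact: (th_tgt thP cq).
Qed.

Lemma thick_fibp E D (u : dghom E D) : P D -> P (cone (fibp u)).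
Proof. exact: th_src (fib_proj_qis u). Qed.

End TwoOfThree.

Lemma thick_acyclic : thick (@acyclic B n f).
Proof.
split.
- move=> E H x /= dx; have [|y ->] := H x; first by zlin (oppeq dx).
  by exists (- y); expand; rewrite opprK.
- move=> E H x dx; have [|y xE] := H x; first by rewrite /= dx oppr0.
  by exists (- y); rewrite {1}xE; expand.
- move=> E F u HE HF [x y] H; pairs H Hx Hy.
  have [|x0 xE] := HE x; first by zlin (oppeq Hx).
  have [|y0 yE] := HF (y + u x0); first by expand; rewrite -hom_d -xE; zlin Hy.
  exists (- x0, y0); congr pair; expand; first by rewrite opprK.
  by zlin yE.
- move=> E F u [u1 _] HF x dx; apply: u1 => //.
  by apply: HF; rewrite -hom_d dx linear0.
- move=> E F u [_ u2] HE y dy; have [x [y' [dx ->]]] := u2 y dy.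
  have [x0 ->] := HE x dx; exists (u x0 + y').
  by rewrite linearD hom_d.
Qed.

Lemma quasi_isoP E F (u : dghom E F) : quasi_iso u <-> acyclic (cone u).
Proof.
split=> [[u1 u2] [x y] H|H].
  pairs H Hx Hy; have dx : dg_d E x = 0 by zlin (oppeq Hx).
  have [|x0 xE] := u1 x dx; first by exists (- y); expand; zlin Hy.
  have [|x1 [y1 [dx1 yE]]] := u2 (y + u x0).
    by expand; rewrite -hom_d -xE; zlin Hy.
  exists (x1 - x0, y1); congr pair; expand; first by rewrite dx1 xE; zmod.
  by zlin yE.
split=> [x dx [y xE]|y dy].
  have [|[x0 y0] E0] := H (x, - y).
    by congr pair; expand; rewrite ?dx ?xE ?oppr0 ?subrr.
  by pairs E0 E1 E2; exists (- x0); expand.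
have [|[x0 y0] E0] := H (0, y).
  by congr pair; expand; rewrite ?dy; zmod.
pairs E0 E1 E2; exists x0, y0; split=> //.
by zlin E1.
Qed.

Lemma quasi_iso_comp E F G (u : dghom E F) (v : dghom F G) :
  quasi_iso u -> quasi_iso v -> quasi_iso (hom_comp v u).
Proof.
move=> /quasi_isoP a /quasi_isoP b; apply/quasi_isoP.
exact: (thick_comp thick_acyclic a b).
Qed.

Lemma quasi_iso_cancell E F G (u : dghom E F) (v : dghom F G) :
  quasi_iso v -> quasi_iso (hom_comp v u) -> quasi_iso u.
Proof.
move=> /quasi_isoP a /quasi_isoP b; apply/quasi_isoP.
exact: (thick_cancell thick_acyclic a b).
Qed.

Lemma quasi_iso_homotopic E F (u v : dghom E F) :
  homotopic u v -> quasi_iso u -> quasi_iso v.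
Proof.
move=> h /quasi_isoP a; apply/quasi_isoP.
exact: (thick_homotopic thick_acyclic h a).
Qed.

Program Definition zerodg : dgmod f :=
  @DgMod B n f ('rV[B]_0 : lmodType B) (fun _ => \0) \0 (fun _ => \0) _ _ _ _ _ _ _ _.
Next Obligation. by move=> i j x /=; rewrite if_same. Qed.
Next Obligation. by move=> x; exists [::]; rewrite ?big_nil //; apply: thinmx0. Qed.
Next Obligation. by []. Qed.
Next Obligation. by []. Qed.
Next Obligation. by []. Qed.
Next Obligation. by []. Qed.
Next Obligation. by move=> a b x /=; rewrite addr0. Qed.
Next Obligation. by move=> a x /=; rewrite addr0 [x]thinmx0 scaler0. Qed.

Lemma zerodg_eq (x y : zerodg) : x = y.
Proof. by rewrite [LHS]thinmx0 [RHS]thinmx0. Qed.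

Lemma perfect_zerodg : perfect zerodg.
Proof.
apply: (@perfect_retract _ _ _ _ _ (hom_zero _ _) (hom_zero _ _)) (perfect_koszul f).
by apply: homotopic_ext => x; apply: zerodg_eq.
Qed.

Lemma perfect_acyclic E : acyclic E -> perfect E.
Proof.
move=> H; apply: (@perfect_qis_src _ _ _ _ _ (hom_zero E zerodg)) perfect_zerodg.
split=> [x dx _|y _]; first exact: H.
by exists 0, 0; split; rewrite ?linear0 //; apply: zerodg_eq.
Qed.

Lemma thick_perfect : thick (@perfect B n f).
Proof.
split.
- exact: perfect_shift.
- exact: perfect_unshift.
- exact: perfect_cone.
- exact: perfect_qis_src.
- exact: perfect_qis_tgt.
Qed.

Lemma quasi_iso_weq E F (u : dghom E F) : quasi_iso u -> perfect (cone u).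
Proof. by move=> /quasi_isoP /perfect_acyclic. Qed.

End Thick.

(** * Noetherian rings *)

Lemma noetherian_submod (B : comPzRingType) (k : nat) (R : 'rV[B]_k -> Prop) :
  noetherian B -> R 0 -> (forall v w, R v -> R w -> R (v + w)) ->
  (forall c v, R v -> R (c *: v)) ->
  exists m (g : 'I_m -> 'rV[B]_k),
    (forall j, R (g j)) /\
    (forall v, R v -> exists c : 'I_m -> B, v = \sum_j c j *: g j).
Proof.
move=> noeB; elim: k R => [|k IH] R R0 RD RZ.
  exists 0, (fun=> 0); split=> [[]|v _] //; exists (fun=> 0).
  by rewrite big_ord0 [v]thinmx0.
have Rsum m (c : 'I_m -> B) (g : 'I_m -> 'rV[B]_k.+1) :
    (forall j, R (g j)) -> R (\sum_j c j *: g j).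
  by move=> Rg; elim/big_ind: _ => // j _; apply: RZ.
have [|||m [g [Rg gR]]] := IH (fun w => R (row_mx (0 : 'rV_1) w : 'rV_(1 + k))).
- by move: R0; rewrite -[0 : 'rV__](@row_mx0 B 1 1 k).
- by move=> v w Rv Rw; rewrite -[0]addr0 -add_row_mx; apply: RD.
- by move=> c v Rv; rewrite -[0](scaler0 _ c) -scale_row_mx; apply: RZ.
pose I a := exists2 v, R v & v 0 0 = a.
have [|r [a aI]] := noeB I.
  split=> [|_ _ [v Rv <-] [w Rw <-]|c _ [v Rv <-]].
  - by exists 0; rewrite ?mxE.
  - by exists (v + w); rewrite ?mxE //; apply: RD.
  - by exists (c *: v); rewrite ?mxE //; apply: RZ.
have /fin_all_exists2 [u Ru ua] : forall j, exists2 v, R v & v 0 0 = a j.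
  move=> j; apply/aI; exists (fun i => (i == j)%:R).
  by rewrite (bigD1 j) //= eqxx mul1r big1 ?addr0 // => i /negPf ->; rewrite mul0r.
pose G (i : 'I_(r + m)) : 'rV[B]_k.+1 :=
  match split i with inl j => u j | inr j => row_mx (0 : 'rV_1) (g j) end.
exists (r + m)%N, G; split=> [i|v Rv].
  by rewrite /G; case: (split i) => j.
have /aI [c cE] : I (v 0 0) by exists v.
have Rw : R (v - \sum_j c j *: u j).
  by rewrite -scaleN1r; apply: (RD _ _ Rv); apply: RZ; apply: Rsum.
set w := v - _ in Rw.
have w0 : w 0 0 = 0.
  rewrite !mxE summxE cE; apply/eqP; rewrite subr_eq0; apply/eqP.
  by apply: eq_bigr => j _; rewrite mxE ua.
have wE : w = row_mx (0 : 'rV_1) (rsubmx (w : 'rV_(1 + k))).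
  rewrite -[LHS](@hsubmxK B 1 1 k); congr (@row_mx B 1 1 k _ _); apply/matrixP => i j.
  rewrite [LHS]mxE [RHS]mxE -w0 !ord1; congr (fun_of_matrix w _ _); exact: val_inj.
have [|c' c'E] := gR (rsubmx (w : 'rV_(1 + k))); first by rewrite -wE.
exists (fun i => match split i with inl j => c j | inr j => c' j end).
have -> : v = \sum_j c j *: u j + w by rewrite addrC subrK.
rewrite big_split_ord /=; congr (_ + _).
  apply: eq_bigr => j _.
  by rewrite /G -[lshift _ _]/(unsplit (inl j)) unsplitK.
have row0_lin : linear (row_mx (0 : 'rV[B]_1) : 'rV_k -> 'rV_(1 + k)).
  by move=> z x y; rewrite scale_row_mx add_row_mx scaler0 addr0.
rewrite wE c'E -[row_mx _ _]/(mklin row0_lin _) linear_sum.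
apply: eq_bigr => j _; rewrite linearZZ /G.
by rewrite -[rshift _ _]/(unsplit (inr j)) unsplitK.
Qed.

(* Hilbert's basis theorem: modulo elements of I realizing generators of the
   ideal of leading coefficients, I reduces to its part of bounded degree, which
   is a submodule of a finite free A-module. *)
Lemma noetherian_poly (A : comNzRingType) : noetherian A -> noetherian {poly A}.
Proof.
move=> noeA I [I0 ID IM].
have Isum (J : finType) (F : J -> {poly A}) : (forall j, I (F j)) -> I (\sum_j F j).
  by move=> IF; elim/big_ind: _.
have IN p : I p -> I (- p) by move=> Ip; rewrite -mulN1r; apply: IM.
pose L a := exists p d, [/\ I p, (size p <= d.+1)%N & p`_d = a].
have [|r [a aL]] := noeA L.
  split.
  - by exists 0, 0%N; rewrite size_poly0 coef0.
  - move=> _ _ [p [d [Ip sp <-]]] [q [e [Iq sq <-]]].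
    exists (p * 'X^e + q * 'X^d), (d + e)%N; split.
    + by apply: ID; rewrite mulrC; apply: IM.
    + apply: leq_trans (size_polyD _ _) _; rewrite geq_max.
      apply/andP; split; apply/leq_sizeP => i ilt; rewrite coefMXn.
        by case: ltnP => // ei; apply/leq_sizeP; [exact: sp | rewrite ltn_subRL addnC].
      by case: ltnP => // ei; apply/leq_sizeP; [exact: sq | rewrite ltn_subRL].
    + by rewrite coefD !coefMXn !ltnNge leq_addr leq_addl addnK addKn.
  - move=> c _ [p [d [Ip sp <-]]]; exists (c%:P * p), d; split; first exact: IM.
      by rewrite mul_polyC; apply: leq_trans (size_scale_leq _ _) sp.
    by rewrite coefCM.
have Lp j : exists p, exists d, [/\ I p, (size p <= d.+1)%N & p`_d = a j].
  apply/aL; exists (fun i => (i == j)%:R).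
  by rewrite (bigD1 j) //= eqxx mul1r big1 ?addr0 // => i /negPf ->; rewrite mul0r.
have [p /fin_all_exists [d pd]] := fin_all_exists Lp.
pose N := (\max_j d j).+1.
have [|||m [g [Ig gI]]] := @noetherian_submod A N (fun v => I (rVpoly v)) noeA.
- by rewrite linear0.
- by move=> v w Iv Iw; rewrite linearD; apply: ID.
- by move=> c v Iv; rewrite linearZ /= -mul_polyC; apply: IM.
pose G (i : 'I_(r + m)) := match split i with inl j => p j | inr j => rVpoly (g j) end.
exists (r + m)%N, G => q; split=> [Iq|[c ->]]; last first.
  apply: Isum => i; apply: IM; rewrite /G; case: (split i) => j //.
  by case: (pd j).
suff [c [c' ->]] : exists c c', q = \sum_j c j * p j + \sum_j c' j * rVpoly (g j).
  exists (fun i => match split i with inl j => c j | inr j => c' j end).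
  rewrite big_split_ord /=; congr (_ + _); apply: eq_bigr => j _.
    by rewrite /G -[lshift _ _]/(unsplit (inl j)) unsplitK.
  by rewrite /G -[rshift _ _]/(unsplit (inr j)) unsplitK.
have [s] := ubnP (size q); elim: s => // s IH in q Iq *; rewrite ltnS => sq.
have [sN|Ns] := leqP (size q) N.
  have [|c cE] := gI (poly_rV q); first by rewrite poly_rV_K.
  exists (fun=> 0), (fun j => (c j)%:P); rewrite big1 => [|j _]; last by rewrite mul0r.
  rewrite add0r -[LHS](poly_rV_K sN) cE linear_sum; apply: eq_bigr => j _.
  by rewrite linearZ /= mul_polyC.
have eE : size q = (size q).-1.+1 by rewrite prednK //; apply: leq_trans Ns.
set e := (size q).-1 in eE.
have dle j : (d j <= e)%N.
  by rewrite -ltnS -eE; apply: leq_trans (ltnW Ns); rewrite ltnS leq_bigmax.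
have /aL [c cE] : L (q`_e) by exists q, e; rewrite -eE.
pose t := \sum_j ((c j)%:P * 'X^(e - d j)) * p j.
have It : I t by apply: Isum => j; apply: IM; case: (pd j).
have [||c1 [c2 qE]] := IH (q - t); first by apply: ID => //; apply: IN.
  apply: leq_trans sq; rewrite eE ltnS; apply/leq_sizeP => i.
  rewrite leq_eqVlt => /predU1P[<-|ei].
    rewrite coefB cE /t coef_sum -sumrB big1 // => j _.
    rewrite -mulrA coefCM mulrC coefXnM ltnNge leq_subr /= subKn //.
    by case: (pd j) => _ _ ->; rewrite mulrC subrr.
  rewrite coefB nth_default ?eE // sub0r /t coef_sum big1 ?oppr0 // => j _.
  rewrite -mulrA coefCM coefXnM; case: ltnP => _; first by rewrite mulr0.
  case: (pd j) => _ /leq_sizeP pj0 _; rewrite pj0 ?mulr0 //.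
  by have := dle j; lia.
exists (fun j => c1 j + (c j)%:P * 'X^(e - d j)), c2.
under eq_bigr do rewrite mulrDl.
by rewrite big_split /= -/t addrAC -qE subrK.
Qed.

Lemma noetherian_finite_type (A : comNzRingType) (B : comPzRingType)
    (phi : {rmorphism A -> B}) :
  noetherian A -> finite_type phi -> noetherian B.
Proof.
move=> noeA [k [b gen]]; elim: k A phi noeA b gen => [|k IH] A phi noeA b gen.
  have phis y : exists a, phi a = y.
    apply: (gen (fun y => exists a, phi a = y)) => [a|[]|x z [a <-] [a' <-]|x z [a <-] [a' <-]] //.
    - by exists a.
    - by exists (a + a'); rewrite rmorphD.
    - by exists (a * a'); rewrite rmorphM.
  move=> I [I0 ID IM]; have [|r [x xI]] := noeA (fun a => I (phi a)).
    split=> [|a a'|a a']; rewrite ?rmorph0 ?rmorphD ?rmorphM //.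
    - exact: ID.
    - exact: IM.
  exists r, (phi \o x) => y; split=> [|[c ->]].
    have [a <-] := phis y => /xI [c ->]; exists (phi \o c).
    by rewrite rmorph_sum; apply: eq_bigr => j _; rewrite rmorphM.
  elim/big_ind: _ => // j _; apply: IM; apply/xI.
  exists (fun i => (i == j)%:R).
  by rewrite (bigD1 j) //= eqxx mul1r big1 ?addr0 // => i /negPf ->; rewrite mul0r.
have [B1|B1] := eqVneq (1 : B) 0.
  have y0 (y : B) : y = 0 by rewrite -[y]mul1r B1 mul0r.
  move=> I [I0 _ _]; exists 0, (fun=> 0) => y; split=> _.
    by exists (fun=> 0); rewrite big_ord0 [y]y0.
  by rewrite [y]y0.
pose B' : comNzRingType := HB.pack B (GRing.PzSemiRing_isNonZero.Build B B1).
pose phi' : {rmorphism A -> B'} := phi.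
have com : commr_rmorph phi' (b ord0) by move=> x; apply: mulrC.
pose psi : {rmorphism {poly A} -> B'} := horner_morph com.
apply: (IH _ (psi : {rmorphism {poly A} -> B}) (noetherian_poly noeA)
  (fun j => b (lift ord0 j))) => P PA Pb PD PM.
apply: gen => // [a|j]; first by have := PA a%:P; rewrite /= horner_morphC.
case: (unliftP ord0 j) => [j' ->|->]; first exact: Pb.
by have := PA 'X; rewrite /= horner_morphX.
Qed.

(** * Coherent and strictly perfect modules *)

Section Coherence.

Variables (B : comPzRingType) (n : nat) (f : 'I_n -> B).
Implicit Types E F G D : dgmod f.

Lemma hgen_tgt E F (u : dghom E F) i k : quasi_iso u -> hgen E i k -> hgen F i k.
Proof.
move=> [_ u2] [z [zc zg]]; exists (u \o z); split=> [j|y py dy].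
  by have [pz dz] := zc j; rewrite /= -hom_pr -hom_d pz dz linear0.
have [x [y' [dx yE]]] := u2 y dy.
have [||c [x' xE]] := zg (dg_pr E i x); first by rewrite dg_prid.
  by rewrite dg_d_pr dx linear0.
exists c, (u x' + dg_pr F (i - 1) y').
rewrite -py yE linearD -hom_pr xE linearD linear_sum linearD dg_d_pr subrK hom_d -addrA.
by congr (_ + _); apply: eq_bigr => j _; rewrite linearZZ.
Qed.

Lemma hgen_src E F (u : dghom E F) i k : quasi_iso u -> hgen F i k -> hgen E i k.
Proof.
move=> [u1 u2] [z [zc zg]].
have /fin_all_exists2 [x xc xz] j : exists2 x, dg_pr E i x = x /\ dg_d E x = 0 &
    exists y, z j = u x + dg_d F y.
  have [pz dz] := zc j; have [x [y [dx zE]]] := u2 _ dz.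
  exists (dg_pr E i x); first by rewrite dg_prid dg_d_pr dx linear0.
  exists (dg_pr F (i - 1) y).
  by rewrite -pz zE linearD hom_pr dg_d_pr subrK.
have /fin_all_exists [y yz] := xz.
exists x; split=> // x0 px0 dx0.
have [||c [y0 E0]] := zg (u x0); rewrite -?hom_pr -?hom_d ?px0 ?dx0 ?linear0 //.
have [||x1 E1] := u1 (x0 - \sum_j c j *: x j).
- rewrite linearB (linear_sum (dg_d E)) dx0 big1 ?subr0 // => j _.
  by have [_ dxj] := xc j; rewrite (linearZZ (dg_d E)) dxj scaler0.
- exists (\sum_j c j *: y j + y0); rewrite (linearB u) (linear_sum u).
  rewrite (linearD (dg_d F)) (linear_sum (dg_d F)) E0.
  rewrite addrAC -sumrB; congr (_ + _); apply: eq_bigr => j _.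
  by rewrite (linearZZ u) (linearZZ (dg_d F)) -scalerBr yz addrAC subrr add0r.
exists c, x1; rewrite -E1; zmod.
Qed.

Lemma hgen_shift E i k : hgen E (i + 1) k -> hgen (shift E) i k.
Proof.
move=> [z [zc zg]]; exists z; split=> [j|x /= px dx].
  by have [pz dz] := zc j; rewrite /= pz dz oppr0.
have [|c [y yE]] := zg x px; first by rewrite -[LHS]opprK dx oppr0.
by exists c, (- y); rewrite yE; expand; rewrite opprK.
Qed.

Lemma hgen_unshift E i k : hgen (shift E) i k -> hgen E (i + 1) k.
Proof.
move=> [z [zc zg]]; exists z; split=> [j|x px dx].
  by have /= [pz dz] := zc j; rewrite pz -[dg_d E _]opprK dz oppr0.
have [|c [y yE]] := zg x px; first by rewrite /= dx oppr0.
by exists c, (- y); rewrite yE; expand.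
Qed.

Lemma hzero_cone E F (u : dghom E F) i :
  hzero E (i + 1) -> hzero F i -> hzero (cone u) i.
Proof.
move=> HE HF [x y] P H; pairs P px py; pairs H Hx Hy.
have dx : dg_d E x = 0 by zlin (oppeq Hx).
have [x0 px0 xE] := hzero_pr HE px dx; rewrite addrK in px0.
have [||y0 yE] := HF (y + u x0).
- by rewrite linearD py -hom_pr px0.
- by expand; rewrite -hom_d -xE; zlin Hy.
exists (- x0, y0); congr pair; expand; first by rewrite opprK.
by zlin yE.
Qed.

Hypothesis noeB : noetherian B.

Lemma hgen_exact E F D (u : dghom F E) (v : dghom E D) i k l :
  (forall x, dg_pr E i x = x -> dg_d E x = 0 -> (exists y, v x = dg_d D y) ->
     exists a b, [/\ dg_pr F i a = a, dg_d F a = 0 & x = u a + dg_d E b]) ->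
  hgen F i k -> hgen D i l -> exists m, hgen E i m.
Proof.
move=> ex [z [zc zg]] [w [wc wg]].
pose R (c : 'rV[B]_l) := exists x y, [/\ dg_pr E i x = x, dg_d E x = 0 &
  v x = \sum_j c 0 j *: w j + dg_d D y].
have [|||m [g [Rg gR]]] := @noetherian_submod B l R noeB.
- exists 0, 0; rewrite !linear0 addr0 big1 // => j _.
  by rewrite mxE scale0r.
- move=> c c' [x [y [px dx vx]]] [x' [y' [px' dx' vx']]].
  exists (x + x'), (y + y'); rewrite !linearD px px' dx dx' addr0; split=> //.
  rewrite vx vx'; under [in RHS]eq_bigr do rewrite mxE scalerDl.
  by rewrite big_split; expand; zmod.
- move=> c c' [x [y [px dx vx]]]; exists (c *: x), (c *: y).
  rewrite !linearZZ px dx scaler0; split=> //.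
  rewrite vx; under [in RHS]eq_bigr do rewrite mxE -scalerA.
  by rewrite -scaler_sumr scalerDr.
have /fin_all_exists [x /fin_all_exists [y xy]] := Rg.
exists (m + k)%N, (fun j => match split j with inl j => x j | inr j => u (z j) end).
split=> [j|x0 px0 dx0].
  case: (split j) => {}j; first by have [] := xy j.
  by have [pz dz] := zc j; rewrite -hom_pr -hom_d pz dz linear0.
have [||c [y0 E0]] := wg (v x0); rewrite -?hom_pr -?hom_d ?px0 ?dx0 ?linear0 //.
have [|c' cE] := gR (\row_j c j).
  exists x0, y0; split=> //; rewrite E0; congr (_ + _).
  by apply: eq_bigr => j _; rewrite mxE.
have [|||a [b [pa da abE]]] := ex (x0 - \sum_j c' j *: x j).
- rewrite linearB (linear_sum (dg_pr E i)) px0; congr (_ - _); apply: eq_bigr => j _.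
  by rewrite linearZZ; have [-> _ _] := xy j.
- rewrite linearB (linear_sum (dg_d E)) dx0 big1 ?subr0 // => j _.
  by rewrite linearZZ; have [_ -> _] := xy j; rewrite scaler0.
- exists (y0 - \sum_j c' j *: y j).
  rewrite (linearB v) (linear_sum v) (linearB (dg_d D)) (linear_sum (dg_d D)) E0 /=.
  rewrite (eq_bigr (fun j => c' j *: (\sum_i (g j) 0 i *: w i) +
    dg_d D (c' j *: y j))) => [|j _]; last first.
    by have [_ _ vx] := xy j; rewrite !linearZZ vx scalerDr.
  rewrite big_split /=.
  suff -> : \sum_(i < m) c' i *: (\sum_i0 g i 0 i0 *: w i0) = \sum_j c j *: w j by zmod.
  under eq_bigr do rewrite scaler_sumr.
  rewrite exchange_big; apply: eq_bigr => j _ /=.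
  have := congr1 (fun r : 'rV_l => r 0 j) cE; rewrite /= mxE summxE => ->.
  by rewrite scaler_suml; apply: eq_bigr => j' _; rewrite mxE scalerA.
have [c2 [b2 aE]] := zg a pa da.
exists (fun j => match split j with inl j => c' j | inr j => c2 j end), (u b2 + b).
rewrite big_split_ord /=.
rewrite (eq_bigr (fun j => c' j *: x j)) => [|j _]; last first.
  by rewrite -[lshift _ _]/(unsplit (inl j)) unsplitK.
rewrite [X in _ + X + _](eq_bigr (fun j => u (c2 j *: z j))) => [|j _]; last first.
  by rewrite -[rshift _ _]/(unsplit (inr j)) unsplitK linearZZ.
rewrite -(linear_sum u) linearD -hom_d.
have ua : u a = u (\sum_j c2 j *: z j) + u (dg_d F b2) by rewrite aE linearD.
by zlin (addeq abE ua).
Qed.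

Lemma hgen_cone E F (u : dghom E F) i k l :
  hgen E (i + 1) k -> hgen F i l -> exists m, hgen (cone u) i m.
Proof.
move=> HE HF; apply: (hgen_exact (u := jcone u) (v := pcone u) _ HF (hgen_shift HE)).
move=> [x y] P H; pairs P px py; pairs H Hx Hy; case=> x0 /= xE.
pose x1 := dg_pr E i x0.
have px1 : dg_pr E i x1 = x1 by rewrite dg_prid.
have dx1 : dg_d E x1 = - x.
  by rewrite dg_d_pr -[dg_d E x0]opprK -xE; expand; rewrite px.
exists (y - u x1), (x1, 0); split.
- by rewrite linearB py -hom_pr px1.
- by expand; rewrite -hom_d dx1; expand; zlin Hy.
- by congr pair; expand; rewrite ?dx1; zmod.
Qed.

Lemma coh_boundedP E : coh_bounded E <->
  (exists N : nat, forall i, N%:Z < `|i| -> hzero E i) /\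
  (forall i, exists k, hgen E i k).
Proof.
by split=> -[[N b] g]; split=> //; exists N => i; [move=> lt x|move=> x lt]; apply: b.
Qed.

Lemma thick_coh : thick (@coh_bounded B n f).
Proof.
split.
- move=> E /coh_boundedP[[N b] g]; apply/coh_boundedP; split=> [|i].
    exists N.+1 => i lt; apply/hgen0/hgen_shift/hgen0/b; lia.
  by have [k H] := g (i + 1); exists k; apply: hgen_shift.
- move=> E /coh_boundedP[[N b] g]; apply/coh_boundedP; split=> [|i].
    exists N.+1 => i lt; apply/hgen0; rewrite -(subrK 1 i).
    apply/hgen_unshift/hgen0/b; lia.
  by have [k H] := g (i - 1); exists k; rewrite -(subrK 1 i); apply: hgen_unshift.
- move=> E F u /coh_boundedP[[N b] g] /coh_boundedP[[N' b'] g'];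
  apply/coh_boundedP; split=> [|i].
    by exists (N + N').+1 => i lt; apply: hzero_cone; [apply: b|apply: b']; lia.
  by have [k H] := g (i + 1); have [l H'] := g' i; apply: hgen_cone H H'.
- move=> E F u qu /coh_boundedP[[N b] g]; apply/coh_boundedP; split=> [|i].
    by exists N => i lt; apply/hgen0/(hgen_src qu)/hgen0/b.
  by have [k H] := g i; exists k; apply: hgen_src qu H.
- move=> E F u qu /coh_boundedP[[N b] g]; apply/coh_boundedP; split=> [|i].
    by exists N => i lt; apply/hgen0/(hgen_tgt qu)/hgen0/b.
  by have [k H] := g i; exists k; apply: hgen_tgt qu H.
Qed.

Lemma hgen_retract E F (i : dghom E F) (r : dghom F E) j k :
  homotopic (hom_comp r i) (hom_id E) -> hgen F j k -> hgen E j k.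
Proof.
case=> s [sp sh sd] [z [zc zg]]; exists (r \o z); split=> [l|x px dx].
  by have [pz dz] := zc l; rewrite /= -hom_pr -hom_d pz dz linear0.
have [||c [y yE]] := zg (i x); rewrite -?hom_pr -?hom_d ?px ?dx ?linear0 //.
exists c, (r y - s x).
have := sd x; rewrite /= yE dx linear0 linearD hom_d (linear_sum r).
rewrite (eq_bigr (fun l => c l *: r (z l))) => [|l _]; last by rewrite linearZZ.
by expand => H; zlin (oppeq H).
Qed.

Lemma coh_retract E F (i : dghom E F) (r : dghom F E) :
  homotopic (hom_comp r i) (hom_id E) -> coh_bounded F -> coh_bounded E.
Proof.
move=> ri /coh_boundedP[[N b] g]; apply/coh_boundedP; split=> [|j].
  by exists N => j lt; apply/hgen0/(hgen_retract ri)/hgen0/b.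
by have [k H] := g j; exists k; apply: hgen_retract ri H.
Qed.

Lemma strictly_perfect_coh E : strictly_perfect E -> coh_bounded E.
Proof.
move=> [[N b] g]; apply/coh_boundedP; split=> [|i].
  by exists N => i lt x px _; exists 0; rewrite -px b // linear0.
have [k [s [p [pp ps]]]] := g i.
have [|||m [t [Rt tR]]] := @noetherian_submod B k (fun v => dg_d E (p v) = 0) noeB.
- by rewrite !linear0.
- by move=> v w dv dw; rewrite !linearD dv dw addr0.
- by move=> c v dv; rewrite !linearZZ dv scaler0.
exists m, (p \o t); split=> [j|x px dx]; first by split=> /=.
have [|c cE] := tR (s x); first by rewrite ps.
exists c, 0; rewrite linear0 addr0 -{1}(ps x px) cE (linear_sum p).
by apply: eq_bigr => j _; rewrite linearZZ.
Qed.

End Coherence.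

Section StrictlyPerfect.

Variables (B : comPzRingType) (n : nat) (f : 'I_n -> B).
Implicit Types E F G D : dgmod f.

Lemma strictly_perfect_zero : strictly_perfect (zerodg f).
Proof.
split=> [|i]; first by exists 0%N.
by exists 0%N, \0, \0; split=> [v|x _]; apply: zerodg_eq.
Qed.

Lemma strictly_perfect_shift E : strictly_perfect E -> strictly_perfect (shift E).
Proof.
move=> [[N b] g]; split=> [|i]; last exact: g (i + 1).
by exists N.+1 => i x lt; apply: b; lia.
Qed.

Lemma strictly_perfect_unshift E : strictly_perfect E -> strictly_perfect (unshift E).
Proof.
move=> [[N b] g]; split=> [|i]; last exact: g (i - 1).
by exists N.+1 => i x lt; apply: b; lia.
Qed.

Lemma strictly_perfect_cone E F (u : dghom E F) :
  strictly_perfect E -> strictly_perfect F -> strictly_perfect (cone u).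
Proof.
move=> [[N b] g] [[N' b'] g']; split=> [|i].
  by exists (N + N').+1 => i [x y] lt; congr pair; [apply: b|apply: b']; lia.
have [k [s [p [pp ps]]]] := g (i + 1).
have [k' [s' [p' [pp' ps']]]] := g' i.
have sl : linear (fun z : E * F => row_mx (s z.1) (s' z.2)).
  by move=> c z w; rewrite /= !linearP scale_row_mx add_row_mx.
have pl : linear (fun v => (p (lsubmx v), p' (rsubmx v)) : E * F).
  by move=> c z w; congr pair; rewrite /= !linearP.
exists (k + k')%N, (mklin sl), (mklin pl); split=> [v|[x y] H].
  by congr pair; rewrite /= ?pp ?pp'.
pairs H px py; congr pair.
- by rewrite row_mxKl ps.
- by rewrite row_mxKr ps'.
Qed.

Lemma strictly_perfect_koszul : strictly_perfect (koszul f).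
Proof.
split=> [|i].
  exists n => i x lt; apply/ffunP => S; rewrite !ffunE; case: eqP => // iE.
  have Sn : (#|S| <= n)%N by rewrite -[X in (_ <= X)%N]card_ord max_card.
  by move: lt; rewrite -iE; lia.
have sl : linear (fun x : koszul f =>
    \row_(k < #|{set 'I_n}|) ((x : koszul_car B n) (enum_val k) : B)).
  by move=> c x y; apply/rowP => k; rewrite !mxE !ffunE.
have pl : linear (fun v : 'rV[B]_#|{set 'I_n}| =>
    koszul_pr i [ffun S => v 0 (enum_rank S)] : koszul f).
  move=> c v w; apply/ffunP => S; rewrite !ffunE !mxE.
  by case: eqP => // _; rewrite scaler0 addr0.
exists _, (mklin sl), (mklin pl); split=> [v|x px]; first exact: (@dg_prid _ _ _ (koszul f)).
rewrite -[RHS]px; congr koszul_pr; apply/ffunP => S.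
by rewrite ffunE mxE enum_rankK.
Qed.

End StrictlyPerfect.

Lemma perfect_coh (B : comPzRingType) n (f : 'I_n -> B) (E : dgmod f) :
  noetherian B -> perfect E -> coh_bounded E.
Proof.
move=> noeB; have th := thick_coh f noeB; elim=> {E}.
- exact/strictly_perfect_coh/strictly_perfect_koszul.
- by move=> E _; apply: th_shift.
- by move=> E _; apply: th_unshift.
- by move=> E F u _ cE _ cF; apply: th_cone.
- by move=> E F i r ri _; apply: coh_retract ri.
- by move=> E F u qu _; apply: th_src qu.
- by move=> E F u qu _; apply: th_tgt qu.
Qed.

(** * Free modules over the Koszul algebra *)

Section OrderedSets.

Variable n : nat.
Implicit Types (a : 'I_n) (S : {set 'I_n}).

Lemma enum_setU1 a S : (forall i, i \in S -> (a < i)%N) -> enum (a |: S) = a :: enum S.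
Proof.
move=> aS; have srt (R : {set 'I_n}) : sorted (relpre val ltn) (enum R).
  have -> : enum R = [seq x <- enum 'I_n | x \in R] by rewrite enumT.
  apply: sorted_filter => [i j k|]; first exact: ltn_trans.
  by rewrite -sorted_map val_enum_ord iota_ltn_sorted.
apply: (@irr_sorted_eq _ (relpre val ltn)) => //.
- by move=> i j k; apply: ltn_trans.
- by move=> i /=; rewrite ltnn.
- rewrite /= path_min_sorted //; apply/allP => i; rewrite mem_enum => /aS //.
- by move=> i; rewrite inE !mem_enum !inE.
Qed.

Lemma set_min_ind (P : {set 'I_n} -> Prop) : P set0 ->
  (forall a S, (forall i, i \in S -> (a < i)%N) -> P S -> P (a |: S)) ->
  forall S, P S.
Proof.
move=> P0 PU S; have [k] := ubnP #|S|; elim: k => // k IH in S *; rewrite ltnS => Sk.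
have [->//|[b bS]] := set_0Vmem S.
have [a aS0 amin] := arg_minnP val bS; have aS : a \in S by [].
rewrite -(setD1K aS); apply: PU => [i|].
  by rewrite !inE => /andP[ia iS]; rewrite ltn_neqAle eq_sym ia amin.
by apply: IH; move: Sk; rewrite (cardsD1 a S) aS.
Qed.

End OrderedSets.

Section Koszul.

Variables (B : comPzRingType) (n : nat) (f : 'I_n -> B) (E : dgmod f).
Implicit Types (a : 'I_n) (S : {set 'I_n}) (z : E).

Lemma sgn_min a S : (forall i, i \in S -> (a < i)%N) -> sgn B a S = 1.
Proof.
move=> aS; rewrite /sgn (_ : [set i in S | _] = set0) ?cards0 //.
by apply/setP => i; rewrite !inE; case: (boolP (i \in S)) => //= /aS; lia.
Qed.

Lemma sgnU_lt a (b : 'I_n) S : (forall i, i \in S -> (a < i)%N) -> (a < b)%N ->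
  sgn B b (a |: S) = - sgn B b S.
Proof.
move=> aS ab; rewrite sgnU ?ab ?mulN1r //.
by apply/negP => /aS; rewrite ltnn.
Qed.

Definition heps S z : E := foldr (fun j y => dg_h E j y) z (enum S).

Lemma heps0 z : heps set0 z = z.
Proof. by rewrite /heps enum_set0. Qed.

Lemma hepsU a S z : (forall i, i \in S -> (a < i)%N) ->
  heps (a |: S) z = dg_h E a (heps S z).
Proof. by move=> aS; rewrite /heps enum_setU1. Qed.

Lemma h_heps a S z : dg_h E a (heps S z) =
  if a \in S then 0 else sgn B a S *: heps (a |: S) z.
Proof.
elim/set_min_ind: S => [|b S bS IH].
  rewrite inE sgn_min ?scale1r ?hepsU // => i; rewrite inE //.
rewrite hepsU // !inE; case: (ltngtP a b) => [ab|ba|/val_inj->]; last first.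
- by rewrite eqxx dg_hh.
- have -> : (a == b) = false by apply/eqP => E0; move: ba; rewrite E0 ltnn.
  have := dg_hC a b (heps S z); rewrite IH /=.
  case: ifP => aS; first by rewrite linear0 addr0.
  rewrite linearZZ sgnU_lt // scaleNr setUCA (@hepsU b (a |: S)) => [H|i]; first by zlin H.
  by rewrite !inE => /predU1P[->|/bS].
have abS i : i \in b |: S -> (a < i)%N.
  by rewrite !inE => /predU1P[->|/bS]; lia.
have -> : (a == b) || (a \in S) = false.
  by apply/negP; rewrite -in_setU1 => /abS; rewrite ltnn.
by rewrite hepsU // sgn_min // scale1r hepsU.
Qed.

Lemma d_heps S z : dg_d E z = 0 ->
  dg_d E (heps S z) = \sum_(j in S) (sgn B j S * f j) *: heps (S :\ j) z.
Proof.
move=> dz; elim/set_min_ind: S => [|b S bS IH]; first by rewrite heps0 big_set0.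
have nbS : b \notin S by apply/negP => /bS; rewrite ltnn.
rewrite hepsU // big_setU1 //= setU1K //.
have -> : sgn B b (b |: S) = 1 by rewrite sgnU // ltnn mul1r sgn_min.
have := dg_dh b (heps S z); rewrite IH linear_sum mul1r.
set X := \sum_(j in S) _; set Y := \sum_(j in S) _ => H.
have -> : Y = - X; last by zlin H.
rewrite -sumrN; apply: eq_bigr => j jS; have bj := bS _ jS.
rewrite sgnU_lt // linearZZ mulNr scaleNr; congr (- (_ *: _)).
have -> : (b |: S) :\ j = b |: (S :\ j).
  by apply/setP => i; rewrite !inE; case: (eqVneq i b) => [->|]; rewrite ?neq_ltn ?bj.
by rewrite hepsU // => i; rewrite !inE => /andP[_ /bS].
Qed.

Lemma pr_heps S z : dg_pr E 0 z = z ->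
  dg_pr E (- #|S|%:Z) (heps S z) = heps S z.
Proof.
move=> pz; elim/set_min_ind: S => [|b S bS IH]; first by rewrite heps0 cards0.
have nbS : b \notin S by apply/negP => /bS; rewrite ltnn.
rewrite hepsU // cardsU1 nbS -[in RHS]IH dg_h_pr; congr (dg_pr E _ _); lia.
Qed.

Definition koszul_one : koszul f := [ffun S => (S == set0)%:R] : koszul_car B n.

Lemma pr_koszul_one : dg_pr (koszul f) 0 koszul_one = koszul_one.
Proof.
apply/ffunP => S; rewrite !ffunE; case: (eqVneq S set0) => [->|_].
  by rewrite cards0 eqxx.
by rewrite if_same.
Qed.

Lemma d_koszul_one : dg_d (koszul f) koszul_one = 0.
Proof.
apply/ffunP => S; rewrite !ffunE big1 // => j _; rewrite ffunE.
by rewrite (negPf (_ : j |: S != set0)) ?mulr0 //; apply/set0Pn; exists j; rewrite !inE eqxx.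
Qed.

Lemma koszul_hom z : dg_pr E 0 z = z -> dg_d E z = 0 ->
  exists k : dghom (koszul f) E, k koszul_one = z.
Proof.
move=> pz dz.
pose k (x : koszul f) : E := \sum_S (x : koszul_car B n) S *: heps S z.
have kl : linear k.
  move=> c x y; rewrite /k scaler_sumr -big_split; apply: eq_bigr => S _ /=.
  by rewrite !ffunE scalerDl scalerA.
unshelve eexists (@mkhom B n f (koszul f) E k kl _ _ _) => [i x|x|a x|].
- rewrite /k linear_sum; apply: eq_bigr => S _ /=.
  rewrite linearZZ ffunE -[in RHS](pr_heps S pz) dg_prK.
  by case: eqVneq => _; rewrite ?pr_heps // scale0r scaler0.
- rewrite /k linear_sum /=.
  under eq_bigr do rewrite ffunE scaler_suml.
  under [in RHS]eq_bigr do rewrite linearZZ d_heps // scaler_sumr.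
  rewrite (exchange_big_dep xpredT) //= [RHS](exchange_big_dep xpredT) //=.
  apply: eq_bigr => j _; rewrite [RHS](reindex_onto (fun S => j |: S) (fun S => S :\ j)) /=.
    apply: eq_big => S.
      rewrite !inE eqxx; have [jS|jS] := boolP (j \in S); last by rewrite setU1K // eqxx.
      by apply/esym/negbTE/eqP => H; have := setD11 j (j |: S); rewrite H jS.
    rewrite inE => jS; rewrite setU1K // scalerA; congr (_ *: _).
    by rewrite sgnU // ltnn mul1r mulrA [LHS]mulrC.
  by move=> S jS; rewrite setD1K.
- rewrite /k linear_sum /=.
  under eq_bigr do rewrite ffunE.
  under [in RHS]eq_bigr do rewrite linearZZ h_heps.
  rewrite (bigID (fun S => a \in S)) /= [X in _ + X]big1 ?addr0; last first.
    by move=> S /negPf ->; rewrite scale0r.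
  rewrite [RHS](bigID (fun S => a \in S)) /= [X in X + _]big1 ?add0r; last first.
    by move=> S ->; rewrite scaler0.
  rewrite (reindex_onto (fun S => a |: S) (fun S => S :\ a)) /=; last first.
    by move=> S aS; rewrite setD1K.
  apply: eq_big => S.
    rewrite !inE eqxx /=; have [aS|aS] := boolP (a \in S); last by rewrite setU1K // eqxx.
    by apply/negbTE/eqP => H; have := setD11 a (a |: S); rewrite H aS.
  rewrite !inE eqxx /= => /eqP SE; have aS : a \notin S by rewrite -SE !inE eqxx.
  by rewrite (negPf aS) SE sgnU // ltnn mul1r scalerA mulrC.
rewrite /= /k (bigD1 set0) //= ffunE eqxx scale1r heps0 big1 ?addr0 // => S /negPf S0.
by rewrite ffunE S0 scale0r.
Qed.

End Koszul.

Section FreeCell.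

Variables (B : comPzRingType) (n : nat) (f : 'I_n -> B).
Implicit Types E F G D : dgmod f.

(* K[-m] with its generator e. *)
Record free_cell (m : int) (K : dgmod f) (e : K) : Prop := FreeCell {
  cell_perfect : perfect K;
  cell_strict : strictly_perfect K;
  cell_conc : concentrated_in (m - n%:Z) m K;
  cell_pr : dg_pr K m e = e;
  cell_d : dg_d K e = 0;
  cell_hom : forall E (z : E), dg_pr E m z = z -> dg_d E z = 0 ->
    exists k : dghom K E, k e = z
}.

Lemma free_cell_exists m : exists K e, @free_cell m K e.
Proof.
elim/int_rect: m => [|m [K [e [c1 c2 c3 c4 c5 c6]]]|m [K [e [c1 c2 c3 c4 c5 c6]]]].
- exists (koszul f), (koszul_one f); split.
  + exact: perfect_koszul.
  + exact: strictly_perfect_koszul.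
  + move=> i x lt; apply/ffunP => S; rewrite !ffunE; case: eqP => // iE.
    have Sn : (#|S| <= n)%N by rewrite -[X in (_ <= X)%N]card_ord max_card.
    by move: lt; rewrite -iE; lia.
  + exact: pr_koszul_one.
  + exact: d_koszul_one.
  + by move=> E z; apply: koszul_hom.
- exists (unshift K), e; split.
  + exact: (thick_unshift (thick_perfect f)).
  + exact: strictly_perfect_unshift.
  + by move=> i x lt; apply: c3; lia.
  + by rewrite /= (_ : m.+1%:Z - 1 = m%:Z) //; lia.
  + by rewrite /= c5 oppr0.
  + move=> E z pz dz; have [||k kz] := c6 (shift E) z.
    * by rewrite /= -[RHS]pz; congr (dg_pr E _ _); lia.
    * by rewrite /= dz oppr0.
    * by exists (unshift_hom k).
- exists (shift K), e; split.
  + exact: perfect_shift.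
  + exact: strictly_perfect_shift.
  + by move=> i x lt; apply: c3; lia.
  + by rewrite /= (_ : - m.+1%:Z + 1 = - m%:Z) //; lia.
  + by rewrite /= c5 oppr0.
  + move=> E z pz dz; have [||k kz] := c6 (unshift E) z.
    * by rewrite /= -[RHS]pz; congr (dg_pr E _ _); lia.
    * by rewrite /= dz oppr0.
    * by exists (hom_comp (unshiftK E) (shift_hom k)).
Qed.

End FreeCell.

(** * Quotients and truncations *)

Section Quotient.

Variables (B : comPzRingType) (V : lmodType B).

Record submod := Submod {
  sm_mem :> V -> Prop;
  sm_0 : sm_mem 0;
  sm_D : forall x y, sm_mem x -> sm_mem y -> sm_mem (x + y);
  sm_Z : forall c x, sm_mem x -> sm_mem (c *: x)
}.

Variable U : submod.

Lemma sm_N x : U x -> U (- x).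
Proof. by move=> Ux; rewrite -scaleN1r; apply: sm_Z. Qed.

Definition qrep (x : V) : V := epsilon (inhabits x) (fun y => U (x - y)).

Lemma qrepP x : U (x - qrep x).
Proof.
apply: (epsilon_spec (inhabits x) (fun y => U (x - y))); exists x.
by rewrite subrr; apply: sm_0.
Qed.

Lemma qrep_eq x y : U (x - y) -> qrep x = qrep y.
Proof.
move=> Uxy; rewrite /qrep (_ : (fun z => U (x - z)) = (fun z => U (y - z))).
  have := inhabits y; case: (inhabits x) => x0 [y0].
  by congr epsilon; apply: proof_irrelevance.
apply: functional_extensionality => z; apply: propositional_extensionality.
split=> H.
  rewrite (_ : y - z = (x - z) - (x - y)); last by zmod.
  by apply: sm_D => //; apply: sm_N.
by rewrite (_ : x - z = (x - y) + (y - z)); [apply: sm_D | zmod].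
Qed.

Definition quot : Type := {x : V | qrep x == x}.
HB.instance Definition _ := Choice.on quot.

Definition qpi (x : V) : quot :=
  exist (fun y => qrep y == y) (qrep x) (introT eqP (esym (qrep_eq (qrepP x)))).

Lemma qpi_val (q : quot) : qpi (val q) = q.
Proof. by apply: val_inj; rewrite /=; apply/eqP/(valP q). Qed.

Lemma qpiP x y : qpi x = qpi y <-> U (x - y).
Proof.
split=> [H|Uxy]; last by apply: val_inj; apply: qrep_eq.
have E0 : qrep x = qrep y := congr1 val H.
rewrite (_ : x - y = (x - qrep x) - (y - qrep y)); last by rewrite E0; zmod.
by apply: sm_D; [apply: qrepP | apply/sm_N/qrepP].
Qed.

Lemma qrep_pi x : U (x - val (qpi x)).
Proof. exact: qrepP. Qed.

Definition qadd (p q : quot) : quot := qpi (val p + val q).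
Definition qopp (p : quot) : quot := qpi (- val p).
Definition qscale (c : B) (p : quot) : quot := qpi (c *: val p).

Lemma qaddE x y : qadd (qpi x) (qpi y) = qpi (x + y).
Proof.
apply/qpiP; rewrite (_ : _ - _ = - ((x - val (qpi x)) + (y - val (qpi y)))); last by zmod.
by apply/sm_N/sm_D; apply: qrep_pi.
Qed.

Lemma qoppE x : qopp (qpi x) = qpi (- x).
Proof.
apply/qpiP; rewrite (_ : _ - _ = x - val (qpi x)); last by zmod.
exact: qrep_pi.
Qed.

Lemma qscaleE c x : qscale c (qpi x) = qpi (c *: x).
Proof.
apply/qpiP; rewrite -scalerBr -opprB scalerN; apply/sm_N/sm_Z; exact: qrep_pi.
Qed.

Lemma qaddA : associative qadd.
Proof.
move=> p q r; rewrite -(qpi_val p) -(qpi_val q) -(qpi_val r) !qaddE; congr qpi; zmod.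
Qed.

Lemma qaddC : commutative qadd.
Proof. by move=> p q; rewrite /qadd addrC. Qed.

Lemma qadd0 : left_id (qpi 0) qadd.
Proof. by move=> p; rewrite -(qpi_val p) qaddE add0r. Qed.

Lemma qaddN : left_inverse (qpi 0) qopp qadd.
Proof. by move=> p; rewrite -(qpi_val p) qoppE qaddE addNr. Qed.

HB.instance Definition _ := GRing.isZmodule.Build quot qaddA qaddC qadd0 qaddN.

Lemma qscaleA a b p : qscale a (qscale b p) = qscale (a * b) p.
Proof. by rewrite -(qpi_val p) !qscaleE scalerA. Qed.

Lemma qscale1 : left_id 1 qscale.
Proof. by move=> p; rewrite -(qpi_val p) qscaleE scale1r. Qed.

Lemma qscaleDr : right_distributive qscale +%R.
Proof.
by move=> a p q; rewrite -(qpi_val p) -(qpi_val q) [qpi _ + _]qaddE !qscaleE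
  [_ + _ in RHS]qaddE scalerDr.
Qed.

Lemma qscaleDl p : {morph qscale^~ p : a b / a + b}.
Proof.
by move=> a b; rewrite -(qpi_val p) !qscaleE [_ + _ in RHS]qaddE scalerDl.
Qed.

HB.instance Definition _ := GRing.Zmodule_isLmodule.Build B quot
  qscaleA qscale1 qscaleDr qscaleDl.

Lemma qpi_linear : linear (qpi : V -> quot).
Proof.
move=> c x y; transitivity (qadd (qscale c (qpi x)) (qpi y)); last by [].
by rewrite qscaleE qaddE.
Qed.

Lemma qpi_eq0 x : qpi x = 0 <-> U x.
Proof. by rewrite -[X in U X]subr0; apply: qpiP. Qed.

Lemma qlift (W : lmodType B) (g : {linear V -> W}) : (forall x, U x -> g x = 0) ->
  {g' : {linear quot -> W} | forall x, g' (qpi x) = g x}.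
Proof.
move=> g0; have gE x : g (val (qpi x)) = g x.
  by apply/eqP; rewrite eq_sym -subr_eq0 -linearB; apply/eqP/g0/qrep_pi.
have gl : linear (fun q : quot => g (val q)).
  move=> c p q; rewrite -(qpi_val p) -(qpi_val q) -qpi_linear !gE.
  by rewrite linearD linearZZ.
by exists (mklin gl).
Qed.

End Quotient.

Section DgQuotient.

Variables (B : comPzRingType) (n : nat) (f : 'I_n -> B).
Implicit Types E F G D : dgmod f.

Record dgsub E := DgSub {
  ds_sub :> submod E;
  ds_pr : forall i x, ds_sub x -> ds_sub (dg_pr E i x);
  ds_d : forall x, ds_sub x -> ds_sub (dg_d E x);
  ds_h : forall a x, ds_sub x -> ds_sub (dg_h E a x)
}.

Section Def.
Variables (E : dgmod f) (U : dgsub E).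

Let pi : {linear E -> quot U} := mklin (@qpi_linear B E U).

Lemma dgq_lift (g : {linear E -> E}) : (forall x, U x -> U (g x)) ->
  {g' : {linear quot U -> quot U} | forall x, g' (pi x) = pi (g x)}.
Proof. by move=> gU; apply: (qlift (g := pi \o g)) => x /gU /qpi_eq0. Qed.

Definition dgq_pr i := sval (dgq_lift (ds_pr (d := U) i)).
Definition dgq_d := sval (dgq_lift (ds_d (d := U))).
Definition dgq_h a := sval (dgq_lift (ds_h (d := U) a)).

Lemma dgq_prE i x : dgq_pr i (pi x) = pi (dg_pr E i x).
Proof. exact: (svalP (dgq_lift _)). Qed.
Lemma dgq_dE x : dgq_d (pi x) = pi (dg_d E x).
Proof. exact: (svalP (dgq_lift _)). Qed.
Lemma dgq_hE a x : dgq_h a (pi x) = pi (dg_h E a x).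
Proof. exact: (svalP (dgq_lift _)). Qed.

Let piV (q : quot U) : q = pi (val q).
Proof. by rewrite /= qpi_val. Qed.

Program Definition dgquot : dgmod f :=
  @DgMod B n f (quot U : lmodType B) dgq_pr dgq_d dgq_h _ _ _ _ _ _ _ _.
Next Obligation.
move=> i j q; rewrite (piV q) !dgq_prE dg_prK.
by case: eqP => // _; rewrite (linear0 pi).
Qed.
Next Obligation.
move=> q; have [s us xE] := dg_sum (val q : E); exists s => //.
rewrite (piV q); transitivity (pi (\sum_(i <- s) dg_pr E i (val q))).
  by congr (pi _).
by rewrite (linear_sum pi); apply: eq_bigr => i _; rewrite dgq_prE.
Qed.
Next Obligation. by move=> i q; rewrite (piV q) dgq_prE !dgq_dE dgq_prE dg_d_pr. Qed.
Next Obligation. by move=> a i q; rewrite (piV q) dgq_prE !dgq_hE dgq_prE dg_h_pr. Qed.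
Next Obligation. by move=> q; rewrite (piV q) !dgq_dE dg_dd (linear0 pi). Qed.
Next Obligation. by move=> a q; rewrite (piV q) !dgq_hE dg_hh (linear0 pi). Qed.
Next Obligation.
by move=> a b q; rewrite (piV q) !dgq_hE -(linearD pi) dg_hC (linear0 pi).
Qed.
Next Obligation.
move=> a q; rewrite (piV q) dgq_hE !dgq_dE dgq_hE -(linearD pi) dg_dh.
by rewrite (linearZZ pi).
Qed.

Definition dgpi : dghom E dgquot.
Proof.
apply: (@mkhom B n f E dgquot pi) => [c x y|i x|x|a x]; first exact: (linearP pi).
- by rewrite [RHS]dgq_prE.
- by rewrite [RHS]dgq_dE.
- by rewrite [RHS]dgq_hE.
Defined.

Lemma dgpi_surj q : exists x, q = dgpi x.
Proof. by exists (val q); rewrite /= qpi_val. Qed.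

Lemma dgpi_eq0 x : dgpi x = 0 <-> U x.
Proof. exact: qpi_eq0. Qed.

Lemma dgquot_hom F (u : dghom E F) : (forall x, U x -> u x = 0) ->
  exists u' : dghom dgquot F, forall x, u' (dgpi x) = u x.
Proof.
move=> u0; have [g gE] := qlift (g := hom_fun u) u0.
unshelve eexists (@DgHom B n f dgquot F g _ _ _) => [i q|q|a q|//].
- by have [x ->] := dgpi_surj q; rewrite -hom_pr ![g _]gE hom_pr.
- by have [x ->] := dgpi_surj q; rewrite -hom_d ![g _]gE hom_d.
- by have [x ->] := dgpi_surj q; rewrite -hom_h ![g _]gE hom_h.
Qed.

End Def.

Lemma dgpi_qis E (U : dgsub E) :
  (forall x, U x -> dg_d E x = 0 -> exists2 y, U y & x = dg_d E y) ->
  quasi_iso (dgpi U).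
Proof.
move=> ac; split=> [x dx [q xq]|q dq].
  have [y yE] := dgpi_surj q; move: xq; rewrite yE -hom_d => H.
  have Uz : U (x - dg_d E y) by apply/dgpi_eq0; rewrite linearB H subrr.
  have [|z _ zE] := ac _ Uz; first by rewrite linearB dx dg_dd subrr.
  by exists (z + y); rewrite linearD -zE subrK.
have [y yE] := dgpi_surj q; move: dq; rewrite yE -hom_d => /dgpi_eq0 Udy.
have [|z Uz zE] := ac _ Udy; first exact: dg_dd.
exists (y - z), 0; rewrite linearB zE subrr linear0 addr0; split=> //.
by rewrite linearB (iffRL (dgpi_eq0 U z) Uz) subr0.
Qed.

End DgQuotient.

Section Truncation.

Variables (B : comPzRingType) (n : nat) (f : 'I_n -> B).
Implicit Types E F G D : dgmod f.
Variables (c : int) (E : dgmod f).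

Definition low (x : E) : Prop := forall i, c <= i -> dg_pr E i x = 0.

Lemma low_lin a x y : low x -> low y -> low (a *: x + y).
Proof. by move=> lx ly i ci; rewrite linearP lx // ly // scaler0 addr0. Qed.

Lemma low0 : low 0.
Proof. by move=> i _; rewrite linear0. Qed.

Lemma low_pr j x : low x -> low (dg_pr E j x).
Proof. by move=> lx i ci; rewrite dg_prK; case: eqP => // <-; apply: lx. Qed.

Lemma low_h a x : low x -> low (dg_h E a x).
Proof.
move=> lx i ci; rewrite -(addrK 1 i) -dg_h_pr lx ?linear0 //.
by apply: le_trans ci _; rewrite lerDl.
Qed.

(* The dg submodule E^{<c} + d E^{<c}; the quotient by it is tau_{>=c} E. *)
Definition trunc_mem (x : E) : Prop := exists2 y, low y & low (x - dg_d E y).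

Lemma low_trunc x : low x -> trunc_mem x.
Proof. by move=> lx; exists 0; [apply: low0 | rewrite linear0 subr0]. Qed.

Lemma trunc_mem_lin a x y : trunc_mem x -> trunc_mem y -> trunc_mem (a *: x + y).
Proof.
move=> [x' lx lx'] [y' ly ly']; exists (a *: x' + y'); first exact: low_lin.
rewrite (_ : _ - _ = a *: (x - dg_d E x') + (y - dg_d E y')); first exact: low_lin.
by expand; zmod.
Qed.

Definition trunc_sub : submod E.
Proof.
apply: (@Submod B E trunc_mem) => [|x y tx ty|a x tx].
- exact/low_trunc/low0.
- by rewrite -[x]scale1r; apply: trunc_mem_lin.
- by rewrite -[_ *: _]addr0; apply: trunc_mem_lin => //; apply/low_trunc/low0.
Defined.

Program Definition trunc_dgsub : dgsub E := @DgSub _ _ _ E trunc_sub _ _ _.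
Next Obligation.
move=> i x [y ly lxy]; exists (dg_pr E (i - 1) y); first exact: low_pr.
by rewrite dg_d_pr subrK -linearB; apply: low_pr.
Qed.
Next Obligation.
move=> x [y ly lxy]; exists (x - dg_d E y) => //.
by rewrite linearB dg_dd subr0 subrr; apply: low0.
Qed.
Next Obligation.
move=> a x [y ly lxy]; exists (- dg_h E a y).
  by rewrite -scaleN1r -[_ *: _]addr0; apply: low_lin; [apply: low_h|apply: low0].
rewrite (_ : _ - _ = f a *: y + dg_h E a (x - dg_d E y)).
  by apply: low_lin => //; apply: low_h.
by expand; have H := dg_dh a y; zlin H.
Qed.

Definition trunc : dgmod f := dgquot trunc_dgsub.
Definition tpi : dghom E trunc := dgpi trunc_dgsub.

Lemma tpi_surj q : exists x, q = tpi x.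
Proof. exact: dgpi_surj. Qed.

Lemma tpi_eq0 x : tpi x = 0 <-> trunc_mem x.
Proof. exact: dgpi_eq0. Qed.

Lemma trunc_mem_high x i : c < i -> trunc_mem x -> dg_pr E i x = 0.
Proof.
move=> ci [y ly lxy]; have /eqP := lxy i (ltW ci).
have ci1 : c <= i - 1 by lia.
by rewrite linearB -(subrK 1 i) -dg_d_pr ly // linear0 subr0 => /eqP.
Qed.

Lemma trunc_low i q : i < c -> dg_pr trunc i q = 0.
Proof.
move=> ic; have [x ->] := tpi_surj q; rewrite -hom_pr; apply/tpi_eq0/low_trunc => j cj.
by rewrite dg_prK; case: eqP => // ji; move: cj; rewrite ji leNgt ic.
Qed.

Lemma trunc_conc b : (forall i x, b < i -> dg_pr E i x = 0) -> concentrated_in c b trunc.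
Proof.
move=> H i q; rewrite negb_and -!ltNge => /orP[ic|bi]; first exact: trunc_low.
by have [x ->] := tpi_surj q; rewrite -hom_pr H // linear0.
Qed.

Lemma low_exact x : (forall j, j < c -> hzero E j) -> low x -> dg_d E x = 0 ->
  exists2 y, low y & x = dg_d E y.
Proof.
move=> H lx dx; have [s us xE] := dg_sum x.
rewrite xE; elim: s {us xE} => [|i s [y ly yE]].
  by exists 0; [apply: low0 | rewrite big_nil linear0].
rewrite big_cons yE; case: (ltP i c) => ic; last first.
  by exists y => //; rewrite lx // add0r.
have [||z pz zE] := hzero_pr (H i ic) (x := dg_pr E i x); first by rewrite dg_prid.
  by rewrite dg_d_pr dx linear0.
exists (z + y); last by rewrite linearD -zE.
rewrite -[z]scale1r; apply: low_lin => // j cj; apply: dg_pr_neq pz _.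
by apply/eqP; lia.
Qed.

Lemma tpi_qis : (forall j, j < c -> hzero E j) -> quasi_iso tpi.
Proof.
move=> H; apply: dgpi_qis => x [y ly lxy] dx.
have [|l ll lE] := low_exact H lxy; first by rewrite linearB dx dg_dd subrr.
exists (y + l); first by apply: low_trunc; rewrite -[y]scale1r; apply: low_lin.
by rewrite linearD -lE; zmod.
Qed.

Lemma trunc_hom F (u : dghom E F) : (forall i x, i < c -> dg_pr F i x = 0) ->
  exists u' : dghom trunc F, forall x, u' (tpi x) = u x.
Proof.
move=> Fc; apply: dgquot_hom => x [y ly lxy].
have u0 z : low z -> u z = 0.
  move=> lz; apply: pr_ext => i; rewrite linear0.
  by case: (ltP i c) => [/Fc//|ci]; rewrite -hom_pr lz // linear0.
by have := u0 _ lxy; rewrite linearB hom_d (u0 y ly) linear0 subr0.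
Qed.

Lemma trunc_hom_qis F (u : dghom E F) (u' : dghom trunc F) :
  (forall i x, i < c -> dg_pr F i x = 0) ->
  (forall j, c - 1 <= j -> hzero (cone u) j) ->
  (forall x, u' (tpi x) = u x) -> quasi_iso u'.
Proof.
move=> Fc cu uE; apply/quasi_isoP/acyclicP => j [q y] P H.
pairs P pq py; pairs H Hq Hy.
case: (ltP j (c - 1)) => jc.
  exists 0; rewrite linear0 -pq -py trunc_low ?Fc //; lia.
have [x0 qE0] := tpi_surj q; pose x := dg_pr E (j + 1) x0.
have px : dg_pr E (j + 1) x = x by rewrite dg_prid.
have {}qE0 : q = tpi x by rewrite hom_pr -qE0 pq.
have dx : dg_d E x = 0.
  rewrite -(dg_prd px); apply: trunc_mem_high; first by lia.
  apply/tpi_eq0; rewrite hom_d -qE0; zlin (oppeq Hq).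
have [||[x1 y1] xyE] := cu j jc (x, y).
- by congr pair => /=; [rewrite px | rewrite py].
- congr pair; expand; first by rewrite dx oppr0.
  by rewrite -uE -qE0.
pairs xyE xE yE; exists (tpi x1, y1); congr pair; expand.
- by rewrite qE0 xE linearN hom_d.
- by rewrite uE.
Qed.

Lemma trunc_strictly_perfect (s : {linear E -> E}) : strictly_perfect E ->
  (forall y, dg_pr E (c - 1) y = y -> s (dg_d E y) = 0) ->
  (forall x, dg_pr E c x = x -> exists w, s x - x = dg_d E w) ->
  strictly_perfect trunc.
Proof.
move=> [[N b] g] s0 sE; split=> [|i].
  by exists N => i q lt; have [x ->] := tpi_surj q; rewrite -hom_pr b // linear0.
have [k [t [p [pp pt]]]] := g i.
case: (ltgtP i c) => [ic|ci|ic].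
- exists 0%N, \0, \0; split=> [v|q <-]; first exact: linear0.
  by rewrite linear0 trunc_low.
- have [t' tE] : {t' : {linear trunc -> 'rV[B]_k} |
      forall x, t' (tpi x) = (t \o dg_pr E i) x}.
    by apply: qlift => x Ux /=; rewrite trunc_mem_high // linear0.
  exists k, t', (tpi \o p); split=> [v|q pq].
    by rewrite -[LHS](hom_pr tpi) [dg_pr E _ _]pp.
  have [x qE] := tpi_surj q.
  rewrite -[LHS]/(tpi (p (t' q))) {1}qE tE -[(t \o _) x]/(t (dg_pr E i x)).
  by rewrite pt ?dg_prid // hom_pr -qE.
- rewrite {}ic in pp pt *.
  have [t' tE] : {t' : {linear trunc -> 'rV[B]_k} |
      forall x, t' (tpi x) = (t \o (dg_pr E c \o (s \o dg_pr E c))) x}.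
    apply: qlift => x [y ly lxy] /=; have := lxy c (lexx c); rewrite linearB.
    rewrite -{2}(subrK 1 c) -dg_d_pr => /eqP; rewrite subr_eq0 => /eqP ->.
    by rewrite s0 ?dg_prid // !linear0.
  exists k, t', (tpi \o p); split=> [v|q pq].
    by rewrite -[LHS](hom_pr tpi) [dg_pr E _ _]pp.
  have [x qE] := tpi_surj q.
  rewrite -[LHS]/(tpi (p (t' q))) {1}qE tE.
  rewrite -[(t \o _) x]/(t (dg_pr E c (s (dg_pr E c x)))) pt ?dg_prid //.
  have [w wE] := sE _ (dg_prid c x).
  apply/eqP; rewrite -pq {1}qE -hom_pr -subr_eq0 -linearB; apply/eqP/tpi_eq0.
  exists (dg_pr E (c - 1) w).
    by move=> j cj; rewrite dg_prK; case: eqP => // jc; move: cj; lia.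
  rewrite dg_d_pr subrK -wE linearB dg_prid.
  by rewrite (_ : _ - _ - _ = 0); [apply: low0 | zmod].
Qed.

End Truncation.

(** * Lifting from strictly perfect complexes *)

Section Lifting.

Variable B : comPzRingType.
Implicit Types E F G D C S Z : dgmod (nofun B).

Lemma projective_lift S Z (w : {linear S -> Z}) i j : strictly_perfect S ->
  (forall x, dg_pr S i x = x -> exists2 z, dg_pr Z j z = z & w x = dg_d Z z) ->
  exists t : {linear S -> Z}, (forall x, dg_pr Z j (t x) = t x) /\
    (forall x, dg_pr S i x = x -> dg_d Z (t x) = w x).
Proof.
move=> [_ g] wd; have [k [a [p [pp pa]]]] := g i.
have /fin_all_exists2 [z pz zE] : forall l : 'I_k,
    exists2 z, dg_pr Z j z = z & w (p (delta_mx 0 l)) = dg_d Z z.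
  by move=> l; apply: wd.
have tl : linear (fun x => \sum_l a x 0 l *: z l).
  move=> c x y; rewrite scaler_sumr -big_split; apply: eq_bigr => l _ /=.
  by rewrite linearP !mxE scalerDl scalerA.
exists (mklin tl); split=> [x|x px] /=; rewrite linear_sum.
  by apply: eq_bigr => l _; rewrite linearZZ pz.
rewrite -[in RHS](pa x px) [in RHS](row_sum_delta (a x)) (linear_sum p) (linear_sum w).
by apply: eq_bigr => l _; rewrite !linearZZ zE.
Qed.

(* S is bounded above, so the homotopy is built by descending induction on the
   degree, as far down as Z is exact. *)
Lemma null_partial S Z (v : dghom S Z) c : strictly_perfect S ->
  (forall j, c <= j -> hzero Z j) ->
  exists s : {linear S -> Z},
    (forall i x, s (dg_pr S i x) = dg_pr Z (i - 1) (s x)) /\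
    (forall i x, c <= i -> dg_pr S i x = x ->
       v x = dg_d Z (s x) + s (dg_d S x)).
Proof.
move=> spS Zc; have [[N b] _] := spS.
suff H (k : nat) : exists s : {linear S -> Z},
    (forall i x, s (dg_pr S i x) = dg_pr Z (i - 1) (s x)) /\
    (forall i x, N%:Z - k%:Z < i -> c <= i -> dg_pr S i x = x ->
       v x = dg_d Z (s x) + s (dg_d S x)).
  have [s [sp sd]] := H (N + `|c|).+1; exists s; split=> // i x ci px.
  by apply: (sd i) => //; lia.
elim: k => [|k [s [sp sd]]].
  exists \0; split=> [i x|i x Ni _ px] /=; first by rewrite linear0.
  by rewrite -px b ?linear0 ?addr0 //; lia.
set i0 := N%:Z - k%:Z in sd.
have [ic|ci] := ltP i0 c.
  by exists s; split=> // i x ki ci; apply: sd => //; lia.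
have wl : linear (fun x => v x - s (dg_d S x) - dg_d Z (s x)).
  by move=> a x y; expand; expandw s; zmod.
have [x px|t [pt td]] := @projective_lift S Z (mklin wl) i0 (i0 - 1) spS.
  have pd : dg_pr S (i0 + 1) (dg_d S x) = dg_d S x by rewrite dg_prd.
  have [||z pz zE] := hzero_pr (Zc i0 ci) (x := v x - s (dg_d S x) - dg_d Z (s x)).
  - rewrite !linearB -hom_pr px; congr (_ - _ - _).
      by rewrite -{2}pd sp addrK.
    by rewrite -{1}px sp dg_d_pr subrK dg_prid -[in RHS]px sp dg_d_pr subrK.
  - have := sd (i0 + 1) (dg_d S x); rewrite dg_dd linear0 addr0 => H.
    by rewrite !linearB dg_dd subr0 -hom_d H ?subrr //; lia.
  by exists z.
have sl : linear (fun x => s x + t (dg_pr S i0 x)).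
  by move=> a x y; expand; expandw s; expandw t; zmod.
exists (mklin sl); split=> [i x|i x ki ci' px] /=.
  rewrite linearD sp; congr (_ + _); rewrite dg_prK -[in RHS](pt (dg_pr S i0 x)) dg_prK.
  rewrite (inj_eq (addIr _)) (eq_sym i0); case: eqP => [->|_]; first by rewrite pt.
  by rewrite linear0.
have t0 : t (dg_pr S i0 (dg_d S x)) = 0.
  rewrite -(dg_prd px) (@dg_pr_neq _ _ _ _ _ (i + 1)) ?dg_prid ?linear0 //.
  by apply/eqP; lia.
rewrite t0 addr0; have [ii0|ii0] := eqVneq i i0.
  rewrite ii0 in px; rewrite px linearD; have /= H := td x px.
  by rewrite H; zmod.
rewrite (@dg_pr_neq _ _ _ _ _ i _ px) 1?eq_sym // linear0 addr0.
by apply: (sd i) => //; lia.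
Qed.

Lemma nofun_h E F (s : E -> F) (a : 'I_0) x : s (dg_h E a x) = - dg_h F a (s x).
Proof. by case: (notF (ltn_ord a)). Qed.

Lemma nofun_hh E F (s : E -> F) (a : 'I_0) x : s (dg_h E a x) = dg_h F a (s x).
Proof. by case: (notF (ltn_ord a)). Qed.

Lemma null_homotopic S Z (v : dghom S Z) c : strictly_perfect S ->
  (forall i x, i < c -> dg_pr S i x = 0) -> (forall j, c <= j -> hzero Z j) ->
  exists s : {linear S -> Z},
    (forall i x, s (dg_pr S i x) = dg_pr Z (i - 1) (s x)) /\
    (forall x, v x = dg_d Z (s x) + s (dg_d S x)).
Proof.
move=> spS Sc Zc; have [s [sp sd]] := null_partial v spS Zc.
exists s; split=> //.
have rl : linear (fun x => dg_d Z (s x) + s (dg_d S x)).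
  by move=> a x y; expand; expandw s; zmod.
apply: (@homog_eq _ _ _ S Z v (mklin rl)) => i x px /=.
have [ic|ci] := ltP i c; last exact: (sd i).
by rewrite -px Sc // !linear0 addr0.
Qed.

Lemma strict_lift S C D (q : dghom C D) (v : dghom S D) c : strictly_perfect S ->
  (forall i x, i < c -> dg_pr S i x = 0) ->
  (forall j, c <= j -> hzero (cone q) j) ->
  exists v' : dghom S C, homotopic (hom_comp q v') v.
Proof.
move=> spS Sc Qc.
have [s [sp sd]] := null_homotopic (hom_comp (jcone q) v) spS Sc Qc.
have sE x : s x = ((s x).1, (s x).2) by case: (s x).
have v'l : linear (fun x => (s x).1) by move=> a x y; rewrite linearP.
have s2l : linear (fun x => (s x).2) by move=> a x y; rewrite linearP.
unshelve eexists (@mkhom _ _ _ S C _ v'l _ _ _) => [i x|x|a x|].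
- by rewrite /= sp /= subrK.
- by have H := congr1 fst (sd x); rewrite /= in H; zlin (oppeq H).
- exact: (nofun_hh (fun x => (s x).1)).
apply/homotopic_sym/(@homotopicI _ _ _ S D _ _ _ s2l) => [i x|a x|x].
- by rewrite /= sp.
- exact: (nofun_h (fun x => (s x).2)).
- by have H := congr1 snd (sd x); rewrite /= in H *; zlin H.
Qed.

Lemma strict_lift_qis S C D (q : dghom C D) (v : dghom S D) :
  strictly_perfect S -> quasi_iso q ->
  exists v' : dghom S C, homotopic (hom_comp q v') v.
Proof.
move=> spS /quasi_isoP/acyclicP qa; have [[N b] _] := spS.
apply: (@strict_lift _ _ _ _ _ (- N%:Z)) => // i x iN; apply: b; lia.
Qed.

(* With th : S -> G lifting psi and th phi - 1 = -(d k + k d) in degrees >= c,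
   put s = th phi + k d; then s - 1 = -d k in degree c, and s d = th d phi = 0 on
   G^{c-1} since S^{c-1} = 0. *)
Lemma strict_splitting G C S (g : dghom G C) (phi : dghom G S) (psi : dghom S C) c :
  strictly_perfect G -> strictly_perfect S ->
  (forall i x, i < c -> dg_pr S i x = 0) ->
  (forall j, c - 1 <= j -> hzero (cone g) j) ->
  homotopic (hom_comp psi phi) g ->
  exists s : {linear G -> G},
    (forall y, dg_pr G (c - 1) y = y -> s (dg_d G y) = 0) /\
    (forall x, dg_pr G c x = x -> exists w, s x - x = dg_d G w).
Proof.
move=> spG spS Sc gc pg.
have [|th gth] := strict_lift (q := g) psi spS Sc.
  by move=> j cj; apply: gc; lia.
have [k [kp _ kd]] : homotopic (hom_comp g (hom_comp th phi)) g.
  apply: homotopic_trans pg.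
  exact: (homotopic_compr phi gth).
have wl : linear (fun x => (th (phi x) - x, - k x) : cone g).
  by move=> a x y; congr pair; expand; expandw k; zmod.
have wp i x : (th (phi (dg_pr (shift G) i x)) - dg_pr (shift G) i x,
    - k (dg_pr (shift G) i x)) = dg_pr (cone g) i (th (phi x) - x, - k x).
  congr pair => /=; first by rewrite !hom_pr linearB.
  by rewrite kp addrK linearN.
have wd x : (th (phi (dg_d (shift G) x)) - dg_d (shift G) x,
    - k (dg_d (shift G) x)) = dg_d (cone g) (th (phi x) - x, - k x).
  congr pair; expandw k; first by rewrite !hom_d; zmod.
  have /= H := kd x; move: H; rewrite linearN opprK => H; zlin (oppeq H).
have [s [sp sd]] := null_partial
  (@mkhom _ _ _ (shift G) (cone g) _ wl wp wd (nofun_hh _))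
  (strictly_perfect_shift spG) gc.
have sl : linear (fun x => th (phi x) + (s (dg_d G x)).1).
  by move=> a x y; expand; expandw s; zmod.
exists (mklin sl); split=> [y py|x px] /=.
  by rewrite dg_dd linear0 addr0 hom_d -py hom_pr Sc ?linear0 //; lia.
exists (- (s x).1); expand.
have px' : dg_pr (shift G) (c - 1) x = x by rewrite /= subrK.
have H := congr1 fst (sd (c - 1) x (lexx _) px'); rewrite /= in H.
by move: H; expandw s => H; zlin H.
Qed.

End Lifting.

(** * Semi-free approximations *)

Section Approximation.

Variables (B : comPzRingType) (n : nat) (f : 'I_n -> B).
Implicit Types E F G D C K : dgmod f.

Lemma bijective_qis E F (u : dghom E F) (v : F -> E) :
  cancel u v -> cancel v u -> quasi_iso u.
Proof.
move=> uK vK; have vd y : dg_d E (v y) = v (dg_d F y).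
  by apply: (can_inj uK); rewrite hom_d !vK.
split=> [x dx [y xE]|y dy].
  by exists (v y); rewrite vd -xE uK.
exists (v y), 0; rewrite vd dy linear0 addr0 vK; split=> //.
by rewrite -(linear0 u) uK.
Qed.

Section Attach.
Variables (G C K : dgmod f) (g : dghom G C) (k : dghom K (cone g)).

(* k splits into a map K[-1] -> G, whose cone G' is the enlarged approximation,
   and a null homotopy of K[-1] -> G -> C, which extends g to G'. *)
Definition attach_map : dghom (unshift K) G.
Proof.
apply: (@mkhom B n f (unshift K) G (fun w => (k w).1)) => [c x y|i x|x|a x] /=.
- by rewrite linearP.
- by rewrite hom_pr /= subrK.
- by rewrite linearN hom_d /= opprK.
- by rewrite linearN hom_h /= opprK.
Defined.

Definition attach_hom : dghom (cone attach_map) C.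
Proof.
apply: (@mkhom B n f (cone attach_map) C (fun z => - (k z.1).2 + g z.2)) =>
  [c [x y] [x' y']|i [x y]|[x y]|a [x y]]; expand.
- zmod.
- by rewrite addrK !hom_pr.
- by rewrite !hom_d /=; zmod.
- by rewrite opprK !hom_h.
Defined.

Definition attach_cone : dghom (cone k) (cone attach_hom).
Proof.
apply: (@mkhom B n f (cone k) (cone attach_hom) (fun z => ((- z.1, z.2.1), z.2.2))) =>
  [c [x [y z]] [x' [y' z']]|i [x [y z]]|[x [y z]]|a [x [y z]]];
  (congr pair; first congr pair); expand => //; rewrite ?addrK //; zmod.
Defined.

Lemma attach_cone_qis : quasi_iso attach_cone.
Proof.
apply: (@bijective_qis _ _ attach_cone (fun z => (- z.1.1, (z.1.2, z.2)))).
- by move=> [x [y z]] /=; rewrite opprK.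
- by move=> [[x y] z] /=; rewrite opprK.
Qed.

End Attach.

Hypothesis noeB : noetherian B.

Record approximation (m b : int) C G (g : dghom G C) : Prop := Approximation {
  app_perfect : perfect G;
  app_strict : strictly_perfect G;
  app_conc : concentrated_in (m - n%:Z) b G;
  app_coh : coh_bounded (cone g)
}.

Lemma kill_degree m b C G (g : dghom G C) : m <= b -> approximation m b g ->
  (forall j, m < j -> hzero (cone g) j) ->
  exists G' (g' : dghom G' C), approximation m b g' /\
    forall j, m <= j -> hzero (cone g') j.
Proof.
move=> mb ag gm; have [_ /(_ m) [r]] := (coh_boundedP _).1 (app_coh ag).
elim: r G g ag gm => [|r IH] G g ag gm gr.
  exists G, g; split=> // j; rewrite le_eqVlt => /predU1P[<-|]; last exact: gm.
  exact/hgen0.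
have [z [zc zg]] := gr; have [pz dz] := zc ord_max.
have [K [e cK]] := free_cell_exists f m.
have [k ke] := cell_hom cK pz dz.
have q := attach_cone_qis k; have th := thick_coh f noeB.
have Ktop j : m < j -> forall x, dg_pr K j x = 0.
  by move=> mj x; apply: (cell_conc cK); lia.
have ck : hgen (cone k) m r.
  exists (fun j => (0, z (widen_ord (leqnSn r) j))); split=> [j|[w v] P H].
    have [pzj dzj] := zc (widen_ord (leqnSn r) j).
    by split; congr pair; rewrite /= ?linear0 ?oppr0 ?add0r.
  pairs P pw pv; pairs H Hw Hv; have w0 : w = 0 by rewrite -pw Ktop //; lia.
  rewrite w0 linear0 add0r in Hv.
  have [c [y vE]] := zg v pv Hv.
  exists (fun j => c (widen_ord (leqnSn r) j)), (c ord_max *: e, y).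
  set w' := widen_ord _; rewrite w0.
  transitivity (jcone k (\sum_(j < r) c (w' j) *: z (w' j)) +
      dg_d (cone k) (c ord_max *: e, y)); last first.
    congr (_ + _); rewrite (linear_sum (jcone k)); apply: eq_bigr => j _.
    by rewrite (linearZZ (jcone k)).
  congr pair => /=; first by rewrite linearZZ (cell_d cK) scaler0; zmod.
  by rewrite linearZZ ke vE big_ord_recr /=; zmod.
apply: (IH _ (attach_hom k)); last exact: hgen_tgt q ck.
  split.
  - apply: perfect_cone (app_perfect ag).
    exact: (thick_unshift (thick_perfect f) (cell_perfect cK)).
  - apply: strictly_perfect_cone (app_strict ag).
    exact: strictly_perfect_unshift (cell_strict cK).
  - move=> i [x y] lt; congr pair; last exact: (app_conc ag).
    by apply: (cell_conc cK); lia.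
  - apply: (th_tgt th q); apply: (th_cone th); last exact: app_coh ag.
    exact/strictly_perfect_coh/(cell_strict cK).
move=> j mj; apply/hgen0; apply: (hgen_tgt q); apply/hgen0.
apply: hzero_cone; last exact: gm.
by move=> x px _; exists 0; rewrite linear0 -px Ktop //; lia.
Qed.

Lemma approximate C b : coh_bounded C -> (forall j, b < j -> hzero C j) ->
  forall k : nat, exists G (g : dghom G C), approximation (b - k%:Z + 1) b g /\
    forall j, b - k%:Z < j -> hzero (cone g) j.
Proof.
move=> cC Cb; elim=> [|k [G [g [ag gk]]]].
  exists (zerodg f), (hom_zero (zerodg f) C); split.
    split.
    - exact: perfect_zerodg.
    - exact: strictly_perfect_zero.
    - by [].
    - apply: (th_cone (thick_coh f noeB)) => //.
      exact/strictly_perfect_coh/strictly_perfect_zero.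
  move=> j bj; apply: hzero_cone; last by apply: Cb; lia.
  by move=> x _ _; exists 0; apply: zerodg_eq.
have [||j mj|G' [g' [ag' gk']]] := @kill_degree (b - k%:Z) b C G g.
- lia.
- case: ag => p s c h; split=> // i x lt; apply: c; lia.
- exact: gk.
exists G', g'; split=> [|j bj]; last by apply: gk'; lia.
by rewrite (_ : b - _ + 1 = b - k%:Z) //; lia.
Qed.

Lemma strict_model C c b : coh_bounded C ->
  (forall i x, i < c -> dg_pr C i x = 0) -> (forall j, b < j -> hzero C j) ->
  (forall (G : dgmod (nofun B)) (g : dghom G (push C)), strictly_perfect G ->
     exists S (phi : dghom G S) (psi : dghom S (push C)),
       [/\ strictly_perfect S, forall i x, i < c -> dg_pr S i x = 0
         & homotopic (hom_comp psi phi) g]) ->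
  exists T (u : dghom T C), [/\ quasi_iso u, strictly_perfect T
    & concentrated_in c b T].
Proof.
move=> cC Cc Cb fac.
have [G [g [[_ spG Gc _] gk]]] := approximate cC Cb (`|b - c|.+2).
have {}gk j : c - 1 <= j -> hzero (cone g) j by move=> cj; apply: gk; lia.
have [S [phi [psi [spS Sc pg]]]] := fac (push G) (push_hom g) spG.
have [s [s0 sE]] := strict_splitting (G := push G) (g := push_hom g)
  spG spS Sc gk pg.
have [u uE] := trunc_hom g Cc.
exists (trunc c G), u; split.
- exact: trunc_hom_qis Cc gk uE.
- exact: (@trunc_strictly_perfect _ _ _ c G s).
- by apply: trunc_conc => i x bi; apply: Gc; lia.
Qed.

End Approximation.

(** * Perfect complexes over the base *)

Section Push.

Variables (B : comPzRingType) (n : nat) (f : 'I_n -> B).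
Implicit Types E F G C : dgmod f.

Lemma push_homotopic E F (u v : dghom E F) :
  homotopic u v -> homotopic (push_hom u) (push_hom v).
Proof. by case=> s [sp sh sd]; exists s; split=> // a; case: (notF (ltn_ord a)). Qed.

Lemma push_cone E F (u : dghom E F) :
  exists2 c : dghom (cone (push_hom u)) (push (cone u)), quasi_iso c & c =1 id.
Proof.
exists (@mkhom _ _ _ (cone (push_hom u)) (push (cone u)) id (fun c x y => erefl)
  (fun i x => erefl) (fun x => erefl) (nofun_hh _)) => //.
exact: (bijective_qis (v := id : push (cone u) -> cone (push_hom u))).
Qed.

Lemma push_shift E : exists c : dghom (shift (push E)) (push (shift E)), quasi_iso c.
Proof.
exists (@mkhom _ _ _ (shift (push E)) (push (shift E)) id (fun c x y => erefl)
  (fun i x => erefl) (fun x => erefl) (nofun_hh _)).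
exact: (bijective_qis (v := id : push (shift E) -> shift (push E))).
Qed.

End Push.

Section PerfectOverBase.

Variable B : comPzRingType.
Hypothesis noeB : noetherian B.
Implicit Types E F G D C S T : dgmod (nofun B).

Definition push_id E : dghom (push E) E :=
  @mkhom _ _ _ (push E) E id (fun c x y => erefl)
    (fun i x => erefl) (fun x => erefl) (nofun_hh (E := push E) _).

Definition id_push E : dghom E (push E) :=
  @mkhom _ _ _ E (push E) id (fun c x y => erefl)
    (fun i x => erefl) (fun x => erefl) (nofun_hh (F := push E) _).

(* A semi-free G approximating S far below its lowest degree retracts onto S. *)
Lemma strictly_perfect_perfect S : strictly_perfect S -> perfect S.
Proof.
move=> spS; have cS := strictly_perfect_coh noeB spS; have [[N b] _] := spS.
have Sb j : N%:Z < j -> hzero S j.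
  by move=> Nj x px _; exists 0; rewrite linear0 -px b //; lia.
have [G [g [ag gk]]] := approximate noeB cS Sb (N + N).+1.
have [i x iN|j jN|th gth] := strict_lift (q := g) (hom_id S) (c := - N%:Z) spS.
- by apply: b; lia.
- by apply: gk; lia.
exact: perfect_retract gth (app_perfect ag).
Qed.

Lemma shift_hom_qis E F (u : dghom E F) : quasi_iso u -> quasi_iso (shift_hom u).
Proof.
move=> [u1 u2]; split=> [x dx [y xE]|y dy].
  have [||x' ->] := u1 x; first by move: dx => /= dx; zlin (oppeq dx).
    by exists (- y); move: xE => /= ->; expand.
  by exists (- x'); expand; rewrite opprK.
have [|x [y' [dx ->]]] := u2 y; first by move: dy => /= dy; zlin (oppeq dy).
by exists x, (- y'); rewrite /= dx oppr0; split=> //; expand; rewrite opprK.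
Qed.

Lemma unshift_hom_qis E F (u : dghom E (shift F)) :
  quasi_iso u -> quasi_iso (unshift_hom u).
Proof.
move=> [u1 u2]; split=> [x dx [y xE]|y dy].
  have [||x' ->] := u1 x; first by move: dx => /= dx; zlin (oppeq dx).
    by exists (- y); move: xE => /= ->; expand; rewrite opprK.
  by exists (- x'); expand; rewrite opprK.
have [|x [y' [dx ->]]] := u2 y; first by rewrite /= dy oppr0.
by exists x, (- y'); rewrite /= dx oppr0; split=> //; expand.
Qed.

(* Only the closure under retracts is not formal: an approximation of the retract
   factors through S, so by [strict_splitting] its truncation is strictly
   perfect. *)
Lemma strict_resolution E : perfect E ->
  exists S (q : dghom S E), strictly_perfect S /\ quasi_iso q.
Proof.
elim=> {E}.
- exists (koszul (nofun B)), (hom_id _); split; first exact: strictly_perfect_koszul.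
  exact: quasi_iso_id.
- move=> E _ [S [q [sS qq]]]; exists (shift S), (shift_hom q); split.
    exact: strictly_perfect_shift.
  exact: shift_hom_qis.
- move=> E _ [S [q [sS qq]]]; exists (unshift S), (unshift_hom q); split.
    exact: strictly_perfect_unshift.
  exact: unshift_hom_qis.
- move=> E F u _ [S [q [sS qq]]] _ [S' [q' [sS' qq']]].
  have [u' uu'] := strict_lift_qis (hom_comp u q) sS qq'.
  have [c cq _] := cone_map_qis uu' qq qq'.
  by exists (cone u'), c; split=> //; apply: strictly_perfect_cone.
- move=> E F i r ri pF [S [q [sS qq]]].
  have pE := perfect_retract ri pF; have cE := perfect_coh noeB pE.
  have [[N b] _] := (coh_boundedP _).1 cE; have [[N' b'] _] := sS.
  pose c := - (N + N')%N.+1%:Z.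
  have qpi : quasi_iso (tpi c E) by apply: tpi_qis => j jc; apply: b; lia.
  have [|i0 x lt|j jN|G g sG|T [u [uq sT _]]] :=
    @strict_model B 0 (nofun B) noeB (trunc c E) c N%:Z.
  + exact: (th_tgt (thick_coh _ noeB) qpi cE).
  + exact: (trunc_low _ lt).
  + by apply/hgen0/(hgen_tgt qpi)/hgen0/b; lia.
  + have [g0 g0E] := strict_lift_qis (hom_comp (push_id _) g) sG qpi.
    have [phi phiE] := strict_lift_qis (hom_comp i g0) sG qq.
    pose w := hom_comp (id_push _) (tpi c E).
    exists S, phi, (hom_comp w (hom_comp r q)); split.
    * exact: sS.
    * by move=> i0 x lt; apply: b'; lia.
    * apply: homotopic_trans (homotopic_compl (hom_comp w r) phiE) _.
      apply: homotopic_trans (homotopic_compl w (homotopic_compr g0 ri)) _.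
      apply: homotopic_trans (homotopic_compl (id_push _) g0E) _.
      exact: homotopic_ext.
  have [v vE] := strict_lift_qis u sT qpi.
  exists T, v; split=> //; apply: quasi_iso_cancell qpi _.
  exact: quasi_iso_homotopic (homotopic_sym vE) uq.
- move=> E F u qu _ [S [q [sS qq]]].
  have [v vE] := strict_lift_qis q sS qu.
  exists S, v; split=> //; apply: quasi_iso_cancell qu _.
  exact: quasi_iso_homotopic (homotopic_sym vE) qq.
- move=> E F u qu _ [S [q [sS qq]]].
  by exists S, (hom_comp u q); split=> //; apply: quasi_iso_comp.
Qed.

Section Fixed.
Variables (n : nat) (f : 'I_n -> B).

Lemma push_perfect (E : dgmod f) : perfect E -> perfect (push E).
Proof.
elim=> {E}.
- apply: strictly_perfect_perfect; exact: strictly_perfect_koszul.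
- move=> E _ pE; have [c cq] := push_shift E.
  by apply: perfect_qis_tgt cq _; apply: perfect_shift.
- move=> E _ pE; have [c cq] := push_shift E.
  by apply: perfect_unshift; apply: perfect_qis_src cq _.
- move=> E F u _ pE _ pF; have [c cq _] := push_cone u.
  by apply: perfect_qis_tgt cq _; apply: perfect_cone.
- move=> E F i r /push_homotopic ri _.
  exact: (@perfect_retract _ _ _ _ _ (push_hom i) (push_hom r) ri).
- by move=> E F u qu _; apply: perfect_qis_src (push_hom u) qu.
- by move=> E F u qu _; apply: perfect_qis_tgt (push_hom u) qu.
Qed.

Lemma push_weq (E F : dgmod f) (u : dghom E F) :
  perfect (cone u) -> perfect (cone (push_hom u)).
Proof.
by move=> /push_perfect pu; have [c cq _] := push_cone u; apply: perfect_qis_src cq pu.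
Qed.

Lemma jcone_weq (E F : dgmod f) (u : dghom E F) :
  perfect E -> perfect (cone (jcone u)).
Proof.
by move=> pE; apply: perfect_qis_src (jcone_proj_qis u) _; apply: perfect_shift.
Qed.

Lemma relperfect_model (E : dgmod f) : coh_bounded E -> perfect (push E) ->
  exists (C T : dgmod f) (w1 : dghom E C) (w2 : dghom T C) m,
    [/\ perfect (cone w1), perfect (cone w2), strictly_perfect T
      & concentrated_in m (m + n%:Z) T].
Proof.
move=> cE pE; have [[N b] _] := (coh_boundedP _).1 cE.
have [S [q [sS qq]]] := strict_resolution pE; have [[N' b'] _] := sS.
pose a := - (N + N')%N.+1%:Z.
have qpi : quasi_iso (tpi a E) by apply: tpi_qis => j jc; apply: b; lia.
have cE' := th_tgt (thick_coh _ noeB) qpi cE.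
have E'b j : N%:Z < j -> hzero (trunc a E) j.
  by move=> Nj; apply/hgen0/(hgen_tgt qpi)/hgen0/b; lia.
have [P [p [[pP sP Pc cC] pk]]] := approximate noeB cE' E'b (2 * N + N').+1.
pose c := N%:Z - (2 * N + N').+1%:Z - n%:Z.
have qpush : quasi_iso (push_hom (tpi a E)) := qpi.
have q'q := quasi_iso_comp qq qpush.
have [p' pp'] := strict_lift_qis (S := push P) (push_hom p) sP q'q.
have [r rq _] := cone_map_qis (a := hom_id (push P)) pp' (quasi_iso_id _) q'q.
have [r' rq' _] := push_cone p.
have [i [x y] lt|j jN|G g sG|T [u [uq sT Tc]]] :=
  @strict_model B n f noeB (cone p) c (c + n%:Z) cC.
- by congr pair; [apply: Pc | apply: trunc_low]; lia.
- by apply: pk; lia.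
- have [phi phiE] := strict_lift_qis g sG (quasi_iso_comp rq rq').
  exists (cone p'), phi, (hom_comp r' r); split; [exact: strictly_perfect_cone| |exact: phiE].
  by move=> i [x y] lt; congr pair; [apply: Pc | apply: b']; lia.
exists (cone p), T, (hom_comp (jcone p) (tpi a E)), u, c; split=> //.
  apply: (thick_comp (thick_perfect f)); first exact: quasi_iso_weq.
  exact: jcone_weq.
exact: quasi_iso_weq.
Qed.

End Fixed.
End PerfectOverBase.

(** * Calculus of fractions *)

Local Notation "v \c u" := (hom_comp v u) (at level 40, left associativity).

Section Fractions.

Variables (B : comPzRingType) (n : nat) (f : 'I_n -> B).
Implicit Types E F G D C Q Z : dgmod f.

Let th := thick_perfect f.
Let weq E F (u : dghom E F) : Prop := perfect (cone u).

Lemma dghom_ext E F (u v : dghom E F) : u =1 v -> u = v.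
Proof.
case: u v => [[u [[u1] [u2]]] up ud uh] [[v [[v1] [v2]]] vp vd vh] /= uv.
have {}uv : u = v by apply: functional_extensionality => x; apply: uv.
case: v / uv v1 v2 vp vd vh => v1 v2 vp vd vh.
rewrite (proof_irrelevance _ v1 u1) (proof_irrelevance _ v2 u2) in vp vd vh *.
by congr DgHom; apply: proof_irrelevance.
Qed.

Lemma hom_compA E F G D (w : dghom G D) (v : dghom F G) (u : dghom E F) :
  w \c (v \c u) = w \c v \c u.
Proof. exact: dghom_ext. Qed.

Lemma hom_compid E F (u : dghom E F) : u \c hom_id E = u.
Proof. exact: dghom_ext. Qed.

Lemma hom_idcomp E F (u : dghom E F) : hom_id F \c u = u.
Proof. exact: dghom_ext. Qed.

Lemma hom_zerocomp E F G (u : dghom E F) : hom_zero F G \c u = hom_zero E G.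
Proof. exact: dghom_ext. Qed.

Lemma hom_compzero E F G (u : dghom F G) : u \c hom_zero E F = hom_zero E G.
Proof. by apply: dghom_ext => x /=; rewrite linear0. Qed.

Lemma hom_subcomp E F G (u v : dghom F G) (w : dghom E F) :
  hom_sub u v \c w = hom_sub (u \c w) (v \c w).
Proof. exact: dghom_ext. Qed.

Lemma hom_compsub E F G (u v : dghom E F) (w : dghom F G) :
  w \c hom_sub u v = hom_sub (w \c u) (w \c v).
Proof. by apply: dghom_ext => x /=; rewrite linearB. Qed.

Lemma cone_factor E F D (w : dghom E D) (x : dghom F D) :
  homotopic (jcone w \c x) (hom_zero _ _) -> exists q, homotopic x (w \c q).
Proof.
case=> s [sp sh sd].
have ql : linear (fun y => (s y).1) by move=> a y z; rewrite linearP.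
have kl : linear (fun y => (s y).2) by move=> a y z; rewrite linearP.
unshelve eexists (@mkhom _ _ _ F E _ ql _ _ _) => [i y|y|a y|].
- by rewrite /= sp /= subrK.
- by have H := congr1 fst (sd y); rewrite /= in H *; zlin (oppeq H).
- by rewrite /= sh /= opprK.
apply: (@homotopicI _ _ _ F D _ _ _ kl) => [i y|a y|y].
- by rewrite /= sp.
- by rewrite /= sh.
- by have H := congr1 snd (sd y); rewrite /= in H *; zlin H.
Qed.

Lemma jcone_null E F (u : dghom E F) : homotopic (jcone u \c u) (hom_zero _ _).
Proof.
apply: (@homotopicI _ _ _ E (cone u) _ _ (fun x => (x, 0))) => [c x y|i x|a x|x];
  congr pair; expand => //; rewrite ?subrK ?opprK //; zmod.
Qed.

Lemma cone_hom E F D (u : dghom E F) (t : dghom F D) :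
  homotopic (t \c u) (hom_zero _ _) -> exists r, r \c jcone u = t.
Proof.
case=> k [kp kh kd].
have rl : linear (fun z : cone u => t z.2 + k z.1).
  by move=> a x y; expand; expandw k; zmod.
unshelve eexists (@mkhom _ _ _ (cone u) D _ rl _ _ _) => [i z|z|a z|].
- by rewrite /= kp hom_pr linearD addrK.
- by have H := kd z.1; expand; expandw k; rewrite /= in H; rewrite hom_d; zlin H.
- by expandw k; rewrite hom_h kh; expand; zmod.
by apply: dghom_ext => x /=; rewrite linear0 addr0.
Qed.

Lemma ore E F G (v : dghom E G) (w : dghom F G) : weq w ->
  exists Z (p : dghom Z E) (q : dghom Z F), weq p /\ homotopic (v \c p) (w \c q).
Proof.
move=> pw; have [|q Hq] := @cone_factor _ _ _ w (v \c fibp (jcone w \c v)).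
  by rewrite hom_compA; apply: fib_null.
exists (fib (jcone w \c v)), (fibp _), q; split=> //.
exact: (thick_fibp th).
Qed.

Lemma weq_cancel E F G (w : dghom F G) (a b : dghom E F) : weq w ->
  homotopic (w \c a) (w \c b) ->
  exists Z (p : dghom Z E), weq p /\ homotopic (a \c p) (b \c p).
Proof.
move=> pw /homotopic_sub0; rewrite -hom_compsub; set d := hom_sub a b.
case=> k [kp kh kd].
have ml : linear (fun x => (d x, - k x) : fib w).
  by move=> c x y; congr pair; expandw k; zmod.
have [m mE] : exists m : dghom E (fib w), fibp w \c m = d.
  unshelve eexists (@mkhom _ _ _ E (fib w) _ ml _ _ _) => [i x|x|c x|].
  - congr pair; first by rewrite -[LHS]/(d (dg_pr E i x)) hom_pr /= subrK.
    by rewrite -[LHS]/(- k (dg_pr E i x)) kp; expand.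
  - congr pair; first by rewrite -[LHS]/(d (dg_d E x)) hom_d /= opprK.
    by have := kd x; expand => H; zlin H.
  - congr pair; first by rewrite -[LHS]/(d (dg_h E c x)) hom_h /= opprK.
    by rewrite -[LHS]/(- k (dg_h E c x)) kh; expand.
  exact: dghom_ext.
exists (fib m), (fibp m); split.
  by apply: (thick_fibp th); apply: (thick_unshift th).
apply/homotopic_sub0; rewrite -hom_subcomp -/d -mE -hom_compA -(hom_compzero _ (fibp w)).
exact/homotopic_compl/fib_null.
Qed.

Lemma weq_comp E F G (u : dghom E F) (v : dghom F G) : weq u -> weq v -> weq (v \c u).
Proof. exact: (thick_comp th). Qed.

Lemma weq_cancell E F G (u : dghom E F) (v : dghom F G) :
  weq v -> weq (v \c u) -> weq u.
Proof. exact: (thick_cancell th). Qed.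

Lemma weq_cancelr E F G (u : dghom E F) (v : dghom F G) :
  weq u -> weq (v \c u) -> weq v.
Proof. exact: (thick_cancelr th). Qed.

Lemma weq_homotopic E F (u v : dghom E F) : homotopic u v -> weq u -> weq v.
Proof. exact: (thick_homotopic th). Qed.

Lemma weq_id E : weq (hom_id E).
Proof. exact/quasi_iso_weq/quasi_iso_id. Qed.

(* A composite of roofs may be checked on a common refinement Z. *)
Lemma roof_compI E F G (r1 : roof E F) (r2 : roof F G) (r : roof E G) Z
    (m1 : dghom Z (roof_apex r1)) (m2 : dghom Z (roof_apex r2))
    (m : dghom Z (roof_apex r)) :
  roof_ok r1 -> weq m1 ->
  homotopic (roof_num r1 \c m1) (roof_den r2 \c m2) ->
  homotopic (roof_den r1 \c m1) (roof_den r \c m) ->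
  homotopic (roof_num r2 \c m2) (roof_num r \c m) ->
  roof_comp r2 r1 r.
Proof.
move=> ok1 wm1 h1 h2 h3; exists Z, m1, m2; split=> //.
exists Z, (hom_id Z), m; rewrite /= !hom_compid; split=> //.
exact: weq_comp.
Qed.

Lemma roof_comp_idl E F (r : roof E F) :
  roof_ok r -> roof_comp (roof_of_hom (hom_id F)) r r.
Proof.
move=> ok; apply: (@roof_compI _ _ _ r (roof_of_hom (hom_id F)) r _
  (hom_id _) (roof_num r) (hom_id _)) => //=.
- exact: weq_id.
- by rewrite hom_compid hom_idcomp; apply: homotopic_refl.
- exact: homotopic_refl.
- by rewrite hom_compid hom_idcomp; apply: homotopic_refl.
Qed.

Lemma roof_comp_idr E F (r : roof E F) :
  roof_ok r -> roof_comp r (roof_of_hom (hom_id E)) r.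
Proof.
move=> ok; apply: (@roof_compI _ _ _ (roof_of_hom (hom_id E)) r r _
  (roof_den r) (hom_id _) (hom_id _)) => //=.
- exact: weq_id.
- by rewrite hom_compid hom_idcomp; apply: homotopic_refl.
- by rewrite hom_compid hom_idcomp; apply: homotopic_refl.
- exact: homotopic_refl.
Qed.

End Fractions.

Add Parametric Relation (B : comPzRingType) (n : nat) (f : 'I_n -> B)
    (E F : dgmod f) : (dghom E F) (@homotopic B n f E F)
  reflexivity proved by (@homotopic_refl B n f E F)
  symmetry proved by (@homotopic_sym B n f E F)
  transitivity proved by (fun x y z => @homotopic_trans B n f E F y x z)
  as homotopic_equivalence.

Add Parametric Morphism (B : comPzRingType) (n : nat) (f : 'I_n -> B)
    (E F G : dgmod f) : (@hom_comp B n f E F G)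
  with signature (@homotopic B n f F G) ==> (@homotopic B n f E F)
    ==> (@homotopic B n f E G) as hom_comp_homotopic.
Proof.
move=> v v' vv' u u' uu'.
exact: homotopic_trans (homotopic_compl v uu') (homotopic_compr u' vv').
Qed.

Local Notation "u ~ v" := (homotopic u v) (at level 70).

Section Idempotent.

Variables (B : comPzRingType) (n : nat) (f : 'I_n -> B).
Implicit Types E F G D C Q R Z : dgmod f.

Lemma whisker E F F' G D (a : dghom F G) (b : dghom E F) (c : dghom F' G)
    (d : dghom E F') (w : dghom G D) :
  a \c b ~ c \c d -> w \c a \c b ~ w \c c \c d.
Proof. by move=> /(homotopic_compl w); rewrite !hom_compA. Qed.

(* As morphisms to the apex, s is den^-1 and t is den^-1 o e, after the
   identification of Q with E by den o s; so s - t represents 1 - e. *)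
Lemma roof_idempotent E (e : roof E E) : roof_ok e -> roof_comp e e e ->
  exists Q (s t : dghom Q (roof_apex e)),
    [/\ perfect (cone s), roof_num e \c s ~ roof_den e \c t
      & roof_num e \c t ~ roof_num e \c s].
Proof.
move=> ok [Q [u [v [wu uv [Q' [p [q /= [h1 h2 w]]]]]]]].
have [|Q2 [r [wr hr]]] := @weq_cancel _ _ _ _ _ _ (roof_den e) (u \c p) q ok.
  by rewrite hom_compA.
have wp : perfect (cone p).
  exact: (weq_cancell (weq_comp wu ok)) w.
exists Q2, (u \c p \c r), (v \c p \c r); split.
- exact: weq_comp wr (weq_comp wp wu).
- by rewrite !hom_compA uv; apply: homotopic_refl.
- by rewrite !hom_compA h2 -!hom_compA -hr !hom_compA; apply: homotopic_refl.
Qed.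

End Idempotent.

Lemma push_comp (B : comPzRingType) (n : nat) (f : 'I_n -> B) (E F G : dgmod f)
  (v : dghom F G) (u : dghom E F) : push_hom (v \c u) = push_hom v \c push_hom u.
Proof. exact: dghom_ext. Qed.

Section Base.

Variables (B : comPzRingType) (n : nat) (f : 'I_n -> B).
Hypothesis noeB : noetherian B.

Lemma push_idempotent_zero (E : dgmod f) (e : roof E E) (Q : dgmod f)
    (s t : dghom Q (roof_apex e)) :
  roof_ok e -> perfect (cone s) -> roof_num e \c s ~ roof_den e \c t ->
  sing_zero (push_ob (SingOb e)) -> perfect (push (cone (hom_sub s t))).
Proof.
move=> /(push_weq noeB) oke /(push_weq noeB) ws /push_homotopic st.
case=> Q0 [u [u' [/= h1 h2 w]]].
rewrite !push_comp in st; rewrite hom_zerocomp in h2.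
have wu := weq_cancell oke w.
have [Z [p [q [wp pq]]]] := ore u ws.
have wq : perfect (cone q).
  exact/(weq_cancell ws)/(weq_homotopic pq)/weq_comp.
have [|Z' [r [wr hr]]] := @weq_cancel _ _ _ _ _ _ (push_hom (roof_den e))
    (push_hom t \c q) (hom_zero _ _) oke.
  by rewrite hom_compA -st (whisker _ (homotopic_sym pq)) h2 hom_zerocomp hom_compzero;
    apply: homotopic_refl.
have dq : push_hom (hom_sub s t) \c (q \c r) ~ push_hom s \c (q \c r).
  have -> : push_hom (hom_sub s t) = hom_sub (push_hom s) (push_hom t) by apply: dghom_ext.
  rewrite hom_subcomp; apply: homotopic_trans (homotopic_sub (homotopic_refl _) _) _.
    by rewrite hom_compA hr; apply: homotopic_refl.
  by apply: homotopic_ext => x /=; rewrite subr0.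
have wqr := weq_comp wr wq.
have wd : perfect (cone (push_hom (hom_sub s t))).
  exact/(weq_cancelr wqr)/(weq_homotopic (homotopic_sym dq))/weq_comp.
by have [c cq _] := push_cone (hom_sub s t); apply: perfect_qis_tgt cq wd.
Qed.

End Base.

Section Retract.

Variables (B : comPzRingType) (n : nat) (f : 'I_n -> B).
Implicit Types E F G D C Q R T Z : dgmod f.

Lemma idempotent_retract E (e : roof E E) Q (s t : dghom Q (roof_apex e)) C T
    (w1 : dghom (cone (hom_sub s t)) C) (w2 : dghom T C) :
  roof_ok e -> perfect (cone s) -> roof_num e \c s ~ roof_den e \c t ->
  roof_num e \c t ~ roof_num e \c s ->
  perfect (cone w1) -> perfect (cone w2) ->
  sing_retract (SingOb e) (sing_of T).
Proof.
move=> ok ws st ts ww1 ww2; set dl := hom_sub s t in w1 ww1 *.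
pose den := roof_den e; pose num := roof_num e; pose j := jcone dl.
have [|rho rhoE] := @cone_hom _ _ _ _ _ _ dl num.
  by rewrite /dl hom_compsub; apply: (proj1 (homotopic_sub0 _ _)); apply: homotopic_sym.
have js : j \c s ~ j \c t.
  by apply/homotopic_sub0; rewrite -hom_compsub; apply: jcone_null.
have [Za [pa [qa [wpa hpa]]]] := ore (w1 \c j) ww2.
have [Z1 [p1 [q1 [wp1 h1]]]] := ore w2 ww1.
have [Z2 [p2 [q2 [wp2 h2]]]] := ore (rho \c q1) ok.
pose a : roof E T := Roof (den \c pa) qa.
pose b : roof T E := Roof (p1 \c p2) (num \c q2).
have oka : roof_ok a by apply: weq_comp.
have okb : roof_ok b by apply: weq_comp.
have [X [x [y [wx xy]]]] := ore s wpa.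
have wsx := weq_comp wx ws; have wpay := weq_homotopic xy wsx.
have wy := weq_cancell wpa wpay.
exists a, b; split.
- split=> //; last exact: roof_comp_idl.
  have [X' [x' [y' [wx' xy']]]] := ore (t \c x) wpa.
  have k0 := homotopic_compl (w1 \c j) xy; have k1 := homotopic_compl (w1 \c j) xy'.
  have k2 := homotopic_compl w1 js; rewrite ?hom_compA in k0 k1 k2.
  have [|X2 [x2 [wx2 h]]] := @weq_cancel _ _ _ _ _ _ w2 (qa \c y') (qa \c y \c x') ww2.
    by rewrite ?hom_compA -!hpa -k1 -k0 k2; apply: homotopic_refl.
  apply: (@roof_compI _ _ _ _ _ _ e a a _ (s \c x \c x' \c x2) (y' \c x2)
    (y \c x' \c x2)) => //=.
  + exact: weq_comp wx2 (weq_comp wx' wsx).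
  + have k := homotopic_compl den xy'; rewrite ?hom_compA in k *.
    by rewrite -k st; apply: homotopic_refl.
  + have k := homotopic_compl den xy; rewrite ?hom_compA in k *.
    by rewrite -k; apply: homotopic_refl.
- split=> //; first exact: roof_comp_idr.
  have [V [v [v' [wv hv]]]] := ore q2 ws.
  have k := homotopic_compl num hv; rewrite ?hom_compA in k.
  apply: (@roof_compI _ _ _ _ _ _ b e b _ v (t \c v') v) => //=.
  + by rewrite ?hom_compA k st; apply: homotopic_refl.
  + exact: homotopic_refl.
  + by rewrite ?hom_compA ts -k; apply: homotopic_refl.
have [Y [z [z' [wz hz]]]] := ore (qa \c y) okb.
have [|Y2 [r [wr hr]]] := @weq_cancel _ _ _ _ _ _ w1 (q1 \c p2 \c z')
    (j \c s \c x \c z) ww1.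
  have k0 := homotopic_compl (w1 \c j) xy; have k1 := homotopic_compl w2 hz.
  rewrite ?hom_compA in k0 k1 *.
  by rewrite -h1 -k1 -hpa k0; apply: homotopic_refl.
have [|Y3 [r' [wr' hr']]] := @weq_cancel _ _ _ _ _ _ den (q2 \c z' \c r)
    (t \c x \c z \c r) ok.
  have k := homotopic_compl rho hr; rewrite ?hom_compA rhoE in k *.
  by rewrite -h2 k st; apply: homotopic_refl.
apply: (@roof_compI _ _ _ _ _ _ a b e _ (y \c z \c r \c r') (z' \c r \c r')
  (s \c x \c z \c r \c r')) => //=.
- exact: weq_comp wr' (weq_comp wr (weq_comp wz wy)).
- by rewrite ?hom_compA; rewrite ?hom_compA in hz; rewrite hz; apply: homotopic_refl.
- have k := homotopic_compl den xy; rewrite ?hom_compA in k *.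
  by rewrite -k; apply: homotopic_refl.
- have k := homotopic_compl num hr'; rewrite ?hom_compA in k *.
  by rewrite k ts; apply: homotopic_refl.
Qed.

End Retract.

Theorem theorem2p3p1p7 (A : comNzRingType) (B : comPzRingType)
    (phi : {rmorphism A -> B}) (n : nat) (f : 'I_n -> B) :
  regular_local_ring A -> finite_type phi -> flat phi -> (0 < n)%N ->
  forall X : sing_ob f, is_relsing_ob X ->
  exists Y : sing_ob f,
    [/\ is_relsing_ob Y, sing_retract X Y
      & exists (E : dgmod f) (m : int),
          [/\ strictly_perfect E, concentrated_in m (m + n%:Z) E
            & sing_iso Y (sing_of E)]].
Proof.
move=> [noeA _ _] ft _ _ [E e] [[/= cE ok ee] zE].
have noeB := noetherian_finite_type noeA ft; have th := thick_coh f noeB.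
have [Q [s [t [ws st ts]]]] := roof_idempotent ok ee.
have pC := push_idempotent_zero noeB ok ws st zE.
have cR : coh_bounded (roof_apex e).
  exact: (thick_src th cE (perfect_coh noeB ok)).
have cQ : coh_bounded Q := thick_src th cR (perfect_coh noeB ws).
have [|C [T [w1 [w2 [m [ww1 ww2 sT Tm]]]]]] := relperfect_model noeB _ pC.
  exact: (th_cone th).
have okT : roof_ok (roof_of_hom (hom_id T)) by apply: weq_id.
have idT := roof_comp_idl okT.
exists (sing_of T); split; last 1 first.
- exists T, m; split=> //; exists (roof_of_hom (hom_id T)), (roof_of_hom (hom_id T)).
  by split=> //; split.
- split; first by split=> //; apply: strictly_perfect_coh.
  exists (zerodg _), (hom_zero _ _), (hom_zero _ _); split.
  + by apply: homotopic_ext => x /=.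
  + by apply: homotopic_ext => x /=.
  + apply: perfect_cone; first exact: perfect_zerodg.
    exact: strictly_perfect_perfect.
- exact: idempotent_retract ok ws st ts ww1 ww2.
Qed.
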